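(* Let $\alpha\colon\mathbb{N}\to\mathbb{C}$ be a sequence such that the multiplicative Hankel operator $M(\alpha)$ is bounded on $\ell^2(\mathbb{N})$. Then there exists a sequence $\beta\colon\mathbb{N}\to\mathbb{C}$ such that $N(\beta)=M(\beta)$ is a compact multiplicative Hankel operator on $\ell^2(\mathbb{N})$ and $$\|M(\alpha)-N(\beta)\|_{\mathcal{B}(\ell^2(\mathbb{N}))}=\inf\left\{\|M(\alpha)-K\|_{\mathcal{B}(\ell^2(\mathbb{N}))}\,:\,K\colon\ell^2(\mathbb{N})\to\ell^2(\mathbb{N})\text{ compact}\right\}.$$ Moreover, unless $M(\alpha)$ is compact, such a minimizing compact multiplicative Hankel operator $N(\beta)$ is not unique.
   Context: For a sequence $\alpha\colon\mathbb{N}\to\mathbb{C}$, the multiplicative Hankel operator (Helson matrix) $M(\alpha)$ is defined by the form $\langle M(\alpha)a,b\rangle_{\ell^2(\mathbb{N})}=\sum_{n,m=1}^\infty a(n)\overline{b(m)}\alpha(nm)$ for finitely supported sequences $a,b$; it is called bounded if $|\langle M(\alpha)a,b\rangle|\le C\|a\|_{\ell^2}\|b\|_{\ell^2}$ for all finitely supported $a,b$ and some $C>0$, in which case it extends to a bounded operator on $\ell^2(\mathbb{N})$ with matrix $\{\alpha(nm)\}_{n,m\ge1}$. $\mathcal{B}(\ell^2(\mathbb{N}))$ denotes the bounded operators with the operator norm. *)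

(* Defs.v *)
From Stdlib Require Import Reals.
From Coquelicot Require Import Coquelicot.
Open Scope R_scope.

(* Index convention: a sequence on N = {1,2,3,...} is represented by a
   function x : nat -> C, where x k stands for the (k+1)-th entry.
   A symbol alpha : N -> C is represented by alpha : nat -> C where
   alpha n (n >= 1) is the n-th value; alpha 0 is never used. *)

Fixpoint csum (f : nat -> C) (N : nat) : C :=
  match N with
  | O => RtoC 0
  | S N' => Cplus (csum f N') (f N')
  end.

(* complex series, as a pair of real series (meaningful when convergent) *)
Definition Cseries (f : nat -> C) : C :=
  (Series (fun n => fst (f n)), Series (fun n => snd (f n))).

Definition in_l2 (x : nat -> C) : Prop := ex_series (fun n => (Cmod (x n)) ^ 2).
Definition l2norm (x : nat -> C) : R := sqrt (Series (fun n => (Cmod (x n)) ^ 2)).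

Definition fin_supp (x : nat -> C) (N : nat) : Prop := forall n, (N <= n)%nat -> x n = RtoC 0.

(* boundedness of the form <M(alpha) a, b> = sum_{n,m} a(n) conj(b(m)) alpha(nm)
   on finitely supported sequences *)
Definition mh_bounded (alpha : nat -> C) : Prop :=
  exists c : R, 0 < c /\
    forall (a b : nat -> C) (N : nat), fin_supp a N -> fin_supp b N ->
      Cmod (csum (fun n => csum (fun m =>
               Cmult (Cmult (a n) (Cconj (b m))) (alpha ((n + 1) * (m + 1))%nat)) N) N)
      <= c * l2norm a * l2norm b.

(* operators, acting on sequences; only their action on l^2 matters *)
Definition Op := (nat -> C) -> (nat -> C).

Definition Mop (alpha : nat -> C) : Op :=
  fun x m => Cseries (fun n => Cmult (alpha ((n + 1) * (m + 1))%nat) (x n)).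

Definition op_sub (S T : Op) : Op := fun x n => Cminus (S x n) (T x n).

Definition is_linear_l2 (T : Op) : Prop :=
  forall (x y : nat -> C) (c : C), in_l2 x -> in_l2 y ->
    T (fun n => Cplus (x n) (Cmult c (y n))) = (fun n => Cplus (T x n) (Cmult c (T y n))).

Definition is_bounded_op (T : Op) : Prop :=
  is_linear_l2 T /\
  (forall x, in_l2 x -> in_l2 (T x)) /\
  exists c : R, forall x, in_l2 x -> l2norm (T x) <= c * l2norm x.

Definition opnorm (T : Op) : R :=
  real (Lub_Rbar (fun r => exists x, in_l2 x /\ l2norm x <= 1 /\ r = l2norm (T x))).

Definition is_compact_op (T : Op) : Prop :=
  is_bounded_op T /\
  forall u : nat -> (nat -> C),
    (forall k, in_l2 (u k)) -> (exists c, forall k, l2norm (u k) <= c) ->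
    exists (phi : nat -> nat) (y : nat -> C),
      (forall k, (phi k < phi (S k))%nat) /\ in_l2 y /\
      is_lim_seq (fun k => l2norm (fun n => Cminus (T (u (phi k)) n) (y n))) 0.

Definition dist_compact (T : Op) : Rbar :=
  Glb_Rbar (fun r => exists K, is_compact_op K /\ r = opnorm (op_sub T K)).

Definition best_mh_approx (alpha beta : nat -> C) : Prop :=
  mh_bounded beta /\ is_compact_op (Mop beta) /\
  Finite (opnorm (op_sub (Mop alpha) (Mop beta))) = dist_compact (Mop alpha).

(* Main.v *)
Require Import Defs.
From Stdlib Require Import Reals Lra Lia FunctionalExtensionality IndefiniteDescription Classical.
From Coquelicot Require Import Coquelicot.
Open Scope R_scope.

(** Write T = M(alpha), let e be its distance to the compact operators and D_eps the diagonal
    operator with entries n^(-eps).  Since n^(-eps) is completely multiplicative,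
    D_eps T D_eps = M(alpha n^(-eps)) is a compact multiplicative Hankel operator, and it tends
    to T strongly, together with its adjoint, as eps -> 0.  The minimizer is an infinite convex
    combination of these operators, as in the theorem of Axler, Berg, Jewell and Shields:
    beta = alpha g with g(n) = sum_i a_i n^(-eps_i).  If X = s T - L with s < 1, L compact and
    |X| < e, then for s + b < 1 some average A of operators D_eps T D_eps satisfies
    |X + b (T - A)| < e: for well separated eps_i, a vector splits into a part on which D_eps
    is nearly the identity (X acts there), a part on which it is nearly zero (X + b T acts there,
    with norm about (s + b) e), and a transition part which is small on average over i.
    Iterating with s -> 1 gives |T - M(beta)| <= e.  All eps_i can be taken as small as desired,
    which moves g(n) arbitrarily close to 1 at a prescribed n >= 2, whereas g(n) < 1 always;
    hence non-uniqueness.  If e = 0 then T itself is compact. *)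

(** * Finite sums *)

(** A single difference T - D_eps T D_eps will not do: on the transition zone of D_eps only the
    crude bound |X| + 2|T| is available, and a vector may live entirely there. An average over K
    disjoint zones lowers this cost to order K^(-1/2), since by orthogonality the zones share the
    norm of the vector. The error is then small but positive, so every step needs slack: while s <
    1, the gap between s e and e provides it, and for e = 0 there is none. Compactness enters only
    through tails: e is used in the form that T, followed by deletion of the first N coordinates,
    has norm at most e + delta for large N. The same one-sided condition expresses compactness, and
    since the bilinear form of a multiplicative Hankel matrix is symmetric, estimates on one side
    transfer to the other. The estimates concern finite sections, so that infinite series appear
    only when forms are converted to operators. *)

Fixpoint rsum (f : nat -> R) (N : nat) : R :=
  match N with
  | O => 0
  | S N' => rsum f N' + f N'
  end.

Lemma rsum_ext f g N : (forall n, (n < N)%nat -> f n = g n) -> rsum f N = rsum g N.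
Proof.
  induction N as [|N IH]; intros H; simpl; [easy|].
  rewrite IH, H by (intros; try apply H; lia). easy.
Qed.

Lemma rsum_le f g N : (forall n, (n < N)%nat -> f n <= g n) -> rsum f N <= rsum g N.
Proof.
  induction N as [|N IH]; intros H; simpl; [lra|].
  apply Rplus_le_compat; [apply IH; intros; apply H|apply H]; lia.
Qed.

Lemma rsum_nonneg f N : (forall n, 0 <= f n) -> 0 <= rsum f N.
Proof.
  intros H; induction N as [|N IH]; simpl; [lra|]. specialize (H N); lra.
Qed.

Lemma rsum_plus f g N : rsum (fun n => f n + g n) N = rsum f N + rsum g N.
Proof. induction N as [|N IH]; simpl; [ring|rewrite IH; ring]. Qed.

Lemma rsum_scal c f N : rsum (fun n => c * f n) N = c * rsum f N.
Proof. induction N as [|N IH]; simpl; [ring|rewrite IH; ring]. Qed.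

Lemma rsum_const c N : rsum (fun _ => c) N = INR N * c.
Proof. induction N as [|N IH]; [simpl; ring|]. rewrite S_INR; simpl rsum; rewrite IH; ring. Qed.

Lemma rsum_zero f N : (forall n, (n < N)%nat -> f n = 0) -> rsum f N = 0.
Proof.
  intros H. rewrite (rsum_ext _ (fun _ => 0)) by easy. rewrite rsum_const; ring.
Qed.

Lemma rsum_mono f N N' : (forall n, 0 <= f n) -> (N <= N')%nat -> rsum f N <= rsum f N'.
Proof.
  intros H HN; induction HN as [|N' _ IH]; simpl; [lra|]. specialize (H N'); lra.
Qed.

Lemma rsum_term f N n : (forall n, 0 <= f n) -> (n < N)%nat -> f n <= rsum f N.
Proof.
  intros H Hn. apply Rle_trans with (rsum f (S n)); [|now apply rsum_mono].
  simpl. pose proof (rsum_nonneg f n H); lra.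
Qed.

Lemma rsum_sum_n f n : rsum f (S n) = sum_n f n.
Proof.
  induction n as [|n IH]; [rewrite sum_O; simpl; ring|].
  rewrite sum_Sn, <- IH. easy.
Qed.

Lemma rsum_CS f g N :
  Rabs (rsum (fun n => f n * g n) N)
  <= sqrt (rsum (fun n => f n ^ 2) N) * sqrt (rsum (fun n => g n ^ 2) N).
Proof.
  assert (Hp : forall h : nat -> R, 0 <= rsum (fun n => h n ^ 2) N)
    by (intros; apply rsum_nonneg; intros; apply pow2_ge_0).
  induction N as [|N IH].
  - simpl. rewrite Rabs_R0, sqrt_0; lra.
  - clear Hp.
    assert (Hp : forall h : nat -> R, 0 <= rsum (fun n => h n ^ 2) N)
      by (intros; apply rsum_nonneg; intros; apply pow2_ge_0).
    specialize (IH Hp).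
    cbn [rsum].
    set (A := rsum (fun n => f n ^ 2) N) in *.
    set (B := rsum (fun n => g n ^ 2) N) in *.
    set (X := rsum (fun n => f n * g n) N) in *.
    assert (HA : 0 <= A) by apply Hp. assert (HB : 0 <= B) by apply Hp.
    pose proof (sqrt_pos A); pose proof (sqrt_pos B).
    pose proof (pow2_sqrt A HA); pose proof (pow2_sqrt B HB).
    set (p := sqrt A) in *; set (q := sqrt B) in *.
    set (x := f N); set (y := g N).
    rewrite <- sqrt_mult by (pose proof (pow2_ge_0 x); pose proof (pow2_ge_0 y); lra).
    apply Rle_trans with (p * q + Rabs x * Rabs y).
    { eapply Rle_trans; [apply Rabs_triang|]. rewrite Rabs_mult; lra. }
    pose proof (Rabs_pos x); pose proof (Rabs_pos y).
    rewrite <- (pow2_abs x), <- (pow2_abs y).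
    set (u := Rabs x) in *; set (v := Rabs y) in *.
    rewrite <- (sqrt_pow2 (p * q + u * v)) by nra.
    apply sqrt_le_1_alt. rewrite <- H1, <- H2.
    (* Lagrange's identity: (p^2 + u^2)(q^2 + v^2) - (p q + u v)^2 = (p v - q u)^2. *)
    pose proof (pow2_ge_0 (p * v - q * u)). nra.
Qed.

Lemma csum_ext f g N : (forall n, (n < N)%nat -> f n = g n) -> csum f N = csum g N.
Proof.
  induction N as [|N IH]; intros H; simpl; [easy|].
  rewrite IH, H by (intros; try apply H; lia). easy.
Qed.

Lemma csum_plus f g N : csum (fun n => Cplus (f n) (g n)) N = Cplus (csum f N) (csum g N).
Proof. induction N as [|N IH]; simpl; [ring|rewrite IH; ring]. Qed.

Lemma csum_scal c f N : csum (fun n => Cmult c (f n)) N = Cmult c (csum f N).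
Proof. induction N as [|N IH]; simpl; [ring|rewrite IH; ring]. Qed.

Lemma csum_zero f N : (forall n, (n < N)%nat -> f n = RtoC 0) -> csum f N = RtoC 0.
Proof.
  induction N as [|N IH]; intros H; simpl; [easy|].
  rewrite IH, H by (intros; try apply H; lia). ring.
Qed.

Lemma csum_exchange (f : nat -> nat -> C) M N :
  csum (fun n => csum (fun m => f n m) N) M = csum (fun m => csum (fun n => f n m) M) N.
Proof.
  induction M as [|M IH]; simpl.
  - symmetry; apply csum_zero; easy.
  - rewrite IH, csum_plus. easy.
Qed.

Lemma Cmod_csum f N : Cmod (csum f N) <= rsum (fun n => Cmod (f n)) N.
Proof.
  induction N as [|N IH]; simpl; [rewrite Cmod_0; lra|].
  eapply Rle_trans; [apply Cmod_triangle|lra].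
Qed.

Lemma csum_fst f N : fst (csum f N) = rsum (fun n => fst (f n)) N.
Proof. induction N as [|N IH]; simpl; [easy|rewrite IH; easy]. Qed.

Lemma csum_snd f N : snd (csum f N) = rsum (fun n => snd (f n)) N.
Proof. induction N as [|N IH]; simpl; [easy|rewrite IH; easy]. Qed.

Lemma csum_RtoC f N : csum (fun n => RtoC (f n)) N = RtoC (rsum f N).
Proof.
  induction N as [|N IH]; simpl; [easy|]. rewrite IH, RtoC_plus; easy.
Qed.

Lemma csum_extend f N N' : (N <= N')%nat ->
  (forall n, (N <= n)%nat -> f n = RtoC 0) -> csum f N' = csum f N.
Proof.
  intros HN H; induction HN as [|N' HN IH]; simpl; [easy|].
  rewrite IH, H by easy. ring.
Qed.

Lemma rsum_extend f N N' : (N <= N')%nat ->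
  (forall n, (N <= n)%nat -> f n = 0) -> rsum f N' = rsum f N.
Proof.
  intros HN H; induction HN as [|N' HN IH]; simpl; [easy|].
  rewrite IH, H by easy. ring.
Qed.

(** * Norms of finite sections *)

Definition nrm2 (a : nat -> C) (N : nat) : R := rsum (fun n => Cmod (a n) ^ 2) N.
Definition nrm (a : nat -> C) (N : nat) : R := sqrt (nrm2 a N).

Definition scale (d : nat -> R) (a : nat -> C) : nat -> C := fun n => Cmult (RtoC (d n)) (a n).
Definition vadd (a b : nat -> C) : nat -> C := fun n => Cplus (a n) (b n).

Lemma nrm2_nonneg a N : 0 <= nrm2 a N.
Proof. apply rsum_nonneg; intros; apply pow2_ge_0. Qed.

Lemma nrm_nonneg a N : 0 <= nrm a N.
Proof. apply sqrt_pos. Qed.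

Lemma nrm_sqr a N : nrm a N ^ 2 = nrm2 a N.
Proof. apply pow2_sqrt, nrm2_nonneg. Qed.

Lemma nrm_le_of_sqr a N c : 0 <= c -> nrm2 a N <= c ^ 2 -> nrm a N <= c.
Proof.
  intros Hc H. unfold nrm. rewrite <- (sqrt_pow2 c Hc). now apply sqrt_le_1_alt.
Qed.

Lemma nrm2_ext a b N : (forall n, (n < N)%nat -> a n = b n) -> nrm2 a N = nrm2 b N.
Proof. intros H; apply rsum_ext; intros n Hn; now rewrite H. Qed.

Lemma nrm_ext a b N : (forall n, (n < N)%nat -> a n = b n) -> nrm a N = nrm b N.
Proof. intros H; unfold nrm; now rewrite (nrm2_ext a b). Qed.

Lemma nrm_mono a N N' : (N <= N')%nat -> nrm a N <= nrm a N'.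
Proof.
  intros H; apply sqrt_le_1_alt, rsum_mono; [|easy]. intros; apply pow2_ge_0.
Qed.

Lemma nrm_coord a N n : (n < N)%nat -> Cmod (a n) <= nrm a N.
Proof.
  intros H. rewrite <- (sqrt_pow2 (Cmod (a n))) by apply Cmod_ge_0.
  apply sqrt_le_1_alt. apply (rsum_term (fun n => Cmod (a n) ^ 2)); [|easy].
  intros; apply pow2_ge_0.
Qed.

Lemma csum_CS a b N : Cmod (csum (fun n => Cmult (a n) (b n)) N) <= nrm a N * nrm b N.
Proof.
  eapply Rle_trans; [apply Cmod_csum|].
  rewrite (rsum_ext _ (fun n => Cmod (a n) * Cmod (b n))) by (intros; apply Cmod_mult).
  eapply Rle_trans; [apply Rle_abs|]. apply rsum_CS.
Qed.

Lemma nrm_triangle a b N : nrm (vadd a b) N <= nrm a N + nrm b N.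
Proof.
  pose proof (nrm_nonneg a N); pose proof (nrm_nonneg b N).
  apply nrm_le_of_sqr; [lra|].
  apply Rle_trans with (rsum (fun n => Cmod (a n) ^ 2 + (Cmod (b n) ^ 2
    + 2 * (Cmod (a n) * Cmod (b n)))) N).
  - apply rsum_le; intros n _.
    pose proof (Cmod_triangle (a n) (b n)). pose proof (Cmod_ge_0 (vadd a b n)).
    unfold vadd in *. nra.
  - rewrite !rsum_plus, rsum_scal.
    pose proof (rsum_CS (fun n => Cmod (a n)) (fun n => Cmod (b n)) N) as HCS.
    pose proof (Rle_abs (rsum (fun n => Cmod (a n) * Cmod (b n)) N)).
    set (X := rsum (fun n => Cmod (a n) * Cmod (b n)) N) in *.
    change (Rabs X <= nrm a N * nrm b N) in HCS.
    change (nrm2 a N + (nrm2 b N + 2 * X) <= (nrm a N + nrm b N) ^ 2).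
    rewrite <- !nrm_sqr. nra.
Qed.

Lemma nrm2_scale d a N :
  nrm2 (scale d a) N = rsum (fun n => d n ^ 2 * Cmod (a n) ^ 2) N.
Proof.
  apply rsum_ext; intros n _. unfold scale.
  rewrite Cmod_mult, Cmod_R, Rpow_mult_distr, pow2_abs. easy.
Qed.

Lemma nrm_scale_le d t a N : 0 <= t ->
  (forall n, (n < N)%nat -> a n <> RtoC 0 -> Rabs (d n) <= t) -> nrm (scale d a) N <= t * nrm a N.
Proof.
  intros Ht H. apply nrm_le_of_sqr; [apply Rmult_le_pos; [easy|apply nrm_nonneg]|].
  rewrite Rpow_mult_distr, nrm_sqr, nrm2_scale. unfold nrm2; rewrite <- rsum_scal.
  apply rsum_le; intros n Hn.
  destruct (Ceq_dec (a n) (RtoC 0)) as [E|E].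
  - rewrite E, Cmod_0; simpl; lra.
  - apply Rmult_le_compat_r; [apply pow2_ge_0|].
    rewrite <- (pow2_abs (d n)). apply pow_incr. split; [apply Rabs_pos|now apply H].
Qed.

Lemma nrm_scale_le1 d a N : (forall n, Rabs (d n) <= 1) -> nrm (scale d a) N <= nrm a N.
Proof.
  intros H. rewrite <- (Rmult_1_l (nrm a N)). apply nrm_scale_le; [lra|auto].
Qed.

(** * Cut-offs and orthogonal splittings *)

Definition lo (N n : nat) : R := if Nat.ltb n N then 1 else 0.
Definition hi (N n : nat) : R := if Nat.ltb n N then 0 else 1.
(** For N <= N' this is the indicator of N, ..., N' - 1. Along a chain of cut-offs these functions
    telescope. *)
Definition mid (N N' n : nat) : R := lo N' n - lo N n.

Lemma lo_cases N n : ((n < N)%nat /\ lo N n = 1) \/ ((N <= n)%nat /\ lo N n = 0).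
Proof. unfold lo. destruct (Nat.ltb_spec n N); auto. Qed.

Lemma hi_cases N n : ((n < N)%nat /\ hi N n = 0) \/ ((N <= n)%nat /\ hi N n = 1).
Proof. unfold hi. destruct (Nat.ltb_spec n N); auto. Qed.

Lemma lo_abs N n : Rabs (lo N n) <= 1.
Proof. destruct (lo_cases N n) as [[_ ->]|[_ ->]]; apply Rabs_le; lra. Qed.

Lemma hi_abs N n : Rabs (hi N n) <= 1.
Proof. destruct (hi_cases N n) as [[_ ->]|[_ ->]]; apply Rabs_le; lra. Qed.

Lemma nrm2_split a N N' M : (N <= N')%nat ->
  nrm2 (scale (lo N) a) M + nrm2 (scale (mid N N') a) M + nrm2 (scale (hi N') a) M = nrm2 a M.
Proof.
  intros H. rewrite !nrm2_scale, <- !rsum_plus. apply rsum_ext; intros n _.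
  unfold mid. destruct (lo_cases N n) as [[? ->]|[? ->]], (lo_cases N' n) as [[? ->]|[? ->]],
    (hi_cases N' n) as [[? ->]|[? ->]]; try lia; ring.
Qed.

Lemma vec_split a N N' n :
  a n = Cplus (Cplus (scale (lo N) a n) (scale (mid N N') a n)) (scale (hi N') a n).
Proof.
  unfold scale, mid. rewrite RtoC_minus.
  destruct (lo_cases N n) as [[? ->]|[? ->]], (lo_cases N' n) as [[? ->]|[? ->]],
    (hi_cases N' n) as [[? ->]|[? ->]]; try lia; ring.
Qed.

(** Consecutive blocks are disjoint, so the sum telescopes to the mass between the first and the
    last cut-off. This is the orthogonality behind the averaging argument. *)
Lemma nrm2_mid_sum (Nb : nat -> nat) a M K : (forall i, (Nb i <= Nb (S i))%nat) ->
  rsum (fun i => nrm2 (scale (mid (Nb i) (Nb (S i))) a) M) K <= nrm2 a M.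
Proof.
  intros H.
  assert (HK : (Nb 0 <= Nb K)%nat)
    by (induction K as [|K IH]; [lia|]; specialize (H K); lia).
  enough (E : rsum (fun i => nrm2 (scale (mid (Nb i) (Nb (S i))) a) M) K
              = nrm2 (scale (mid (Nb 0%nat) (Nb K)) a) M).
  { rewrite E. pose proof (nrm2_split a _ _ M HK).
    pose proof (nrm2_nonneg (scale (lo (Nb 0%nat)) a) M).
    pose proof (nrm2_nonneg (scale (hi (Nb K)) a) M). lra. }
  clear HK. induction K as [|K IH]; simpl rsum.
  - symmetry. rewrite nrm2_scale. apply rsum_zero; intros n _. unfold mid; ring.
  - rewrite IH, !nrm2_scale, <- rsum_plus. apply rsum_ext; intros n _.
    assert (HK : (Nb 0 <= Nb K)%nat)
      by (clear IH; induction K as [|K IH]; [lia|]; specialize (H K); lia).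
    specialize (H K). unfold mid.
    destruct (lo_cases (Nb 0%nat) n) as [[? ->]|[? ->]], (lo_cases (Nb K) n) as [[? ->]|[? ->]],
    (lo_cases (Nb (S K)) n) as [[? ->]|[? ->]]; try lia; ring.
Qed.

(** * Bilinear forms of multiplicative Hankel type *)

(* Bilinear rather than sesquilinear, so that the form is symmetric. *)
Definition form (gamma : nat -> C) (M N : nat) (a b : nat -> C) : C :=
  csum (fun n => csum (fun m =>
    Cmult (Cmult (a n) (b m)) (gamma ((n + 1) * (m + 1))%nat)) N) M.

(** The two lengths are independent, so that a fixed vector can be tested against longer and longer
    parts of its image. *)
Definition form_bound (gamma : nat -> C) (c : R) : Prop :=
  forall M N a b, Cmod (form gamma M N a b) <= c * nrm a M * nrm b N.

(** With P the projection onto the first K coordinates, this says that (1 - P) M(gamma) has norm at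
    most c. *)
Definition tail_bound (gamma : nat -> C) (c : R) (K : nat) : Prop :=
  forall M N a b, (forall m, (m < K)%nat -> b m = RtoC 0) ->
    Cmod (form gamma M N a b) <= c * nrm a M * nrm b N.

(** For a bounded form this stands for compactness: M(gamma) is the norm limit of its compressions P
    M(gamma) to finitely many coordinates. *)
Definition vanishing_tail (gamma : nat -> C) : Prop :=
  forall eps, 0 < eps -> exists K, tail_bound gamma eps K.

(** On matrices this is the Schur product with h(nm), so the multiplicative Hankel structure is
    kept. *)
Definition sym_mul (gamma : nat -> C) (h : nat -> R) : nat -> C :=
  fun k => Cmult (gamma k) (RtoC (h k)).

(* The value at [k = 0] is 1, because [ln 0 = 0]. *)
Definition pw (eps : R) (k : nat) : R := exp (- eps * ln (INR k)).
Definition dg (eps : R) (n : nat) : R := pw eps (n + 1).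

Lemma form_ext gamma gamma' M N a a' b b' :
  (forall k, (1 <= k)%nat -> gamma k = gamma' k) ->
  (forall n, (n < M)%nat -> a n = a' n) -> (forall n, (n < N)%nat -> b n = b' n) ->
  form gamma M N a b = form gamma' M N a' b'.
Proof.
  intros Hg Ha Hb. apply csum_ext; intros n Hn. apply csum_ext; intros m Hm.
  rewrite Hg, Ha, Hb by (easy || nia). easy.
Qed.

Lemma form_sym gamma M N a b : form gamma M N a b = form gamma N M b a.
Proof.
  unfold form. rewrite csum_exchange. apply csum_ext; intros n _. apply csum_ext; intros m _.
  rewrite (Nat.mul_comm (m + 1)). ring.
Qed.

Lemma form_add_l gamma M N a a' b :
  form gamma M N (vadd a a') b = Cplus (form gamma M N a b) (form gamma M N a' b).
Proof.
  unfold form. rewrite <- csum_plus. apply csum_ext; intros n _.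
  rewrite <- csum_plus. apply csum_ext; intros m _. unfold vadd. ring.
Qed.

Lemma form_add_r gamma M N a b b' :
  form gamma M N a (vadd b b') = Cplus (form gamma M N a b) (form gamma M N a b').
Proof. now rewrite form_sym, form_add_l, !(form_sym _ N M). Qed.

Lemma form_lin gamma gamma' c M N a b :
  form (fun k => Cplus (gamma k) (Cmult c (gamma' k))) M N a b
  = Cplus (form gamma M N a b) (Cmult c (form gamma' M N a b)).
Proof.
  unfold form. rewrite <- csum_scal, <- csum_plus. apply csum_ext; intros n _.
  rewrite <- csum_scal, <- csum_plus. apply csum_ext; intros m _. ring.
Qed.

Lemma pw_mult eps k l : (1 <= k)%nat -> (1 <= l)%nat -> pw eps (k * l) = pw eps k * pw eps l.
Proof.
  intros Hk Hl. unfold pw. rewrite mult_INR, ln_mult by (apply lt_0_INR; lia).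
  rewrite <- exp_plus. f_equal. ring.
Qed.

Lemma pw_pos eps k : 0 < pw eps k.
Proof. apply exp_pos. Qed.

Lemma ln_INR_nonneg k : 0 <= ln (INR k).
Proof.
  destruct k as [|k].
  - simpl. unfold ln. destruct (Rlt_dec 0 0); [exfalso|]; lra.
  - rewrite <- ln_1. apply ln_le; [lra|]. apply (le_INR 1). lia.
Qed.

Lemma ln_INR_pos k : (2 <= k)%nat -> 0 < ln (INR k).
Proof.
  intros H. rewrite <- ln_1. apply ln_increasing; [lra|]. apply (lt_INR 1). lia.
Qed.

Lemma exp_le x y : x <= y -> exp x <= exp y.
Proof. intros [H| ->]; [left; now apply exp_increasing|lra]. Qed.

Lemma pw_le1 eps k : 0 <= eps -> pw eps k <= 1.
Proof.
  intros H. rewrite <- exp_0. apply exp_le. pose proof (ln_INR_nonneg k). nra.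
Qed.

Lemma pw_lt1 eps k : 0 < eps -> (2 <= k)%nat -> pw eps k < 1.
Proof.
  intros H Hk. rewrite <- exp_0. apply exp_increasing. pose proof (ln_INR_pos k Hk). nra.
Qed.

Lemma pw_antimono eps eps' k : eps <= eps' -> pw eps' k <= pw eps k.
Proof. intros H. apply exp_le. pose proof (ln_INR_nonneg k). nra. Qed.

Lemma dg_abs eps n : 0 <= eps -> Rabs (dg eps n) <= 1.
Proof.
  intros H. apply Rabs_le. pose proof (pw_pos eps (n + 1)). pose proof (pw_le1 eps (n + 1) H).
  unfold dg. lra.
Qed.

Lemma form_pw gamma eps M N a b :
  form (sym_mul gamma (pw eps)) M N a b = form gamma M N (scale (dg eps) a) (scale (dg eps) b).
Proof.
  apply csum_ext; intros n _. apply csum_ext; intros m _. unfold sym_mul, scale, dg.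
  rewrite pw_mult, RtoC_mult by lia. ring.
Qed.

Lemma form_bound_tail gamma c : form_bound gamma c <-> tail_bound gamma c 0.
Proof.
  split; intros H M N a b; [intros _|]; apply H. intros; lia.
Qed.

Lemma tail_bound_mono gamma c K K' : (K <= K')%nat -> tail_bound gamma c K -> tail_bound gamma c K'.
Proof. intros HK H M N a b Hb. apply H. intros; apply Hb; lia. Qed.

Lemma tail_bound_le gamma c c' K : c <= c' -> tail_bound gamma c K -> tail_bound gamma c' K.
Proof.
  intros Hc H M N a b Hb. eapply Rle_trans; [now apply H|].
  pose proof (nrm_nonneg a M); pose proof (nrm_nonneg b N).
  apply Rmult_le_compat_r; [easy|]. now apply Rmult_le_compat_r.
Qed.

Lemma tail_bound_ext gamma gamma' c K :
  (forall k, (1 <= k)%nat -> gamma k = gamma' k) -> tail_bound gamma c K -> tail_bound gamma' c K.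
Proof.
  intros E H M N a b Hb. rewrite (form_ext gamma' gamma M N a a b b); auto.
  intros; symmetry; auto.
Qed.

Lemma Cmod_plus_le x y p q : Cmod x <= p -> Cmod y <= q -> Cmod (Cplus x y) <= p + q.
Proof. intros. eapply Rle_trans; [apply Cmod_triangle|lra]. Qed.

Lemma Cmod_scal_le t x p : Cmod x <= p -> Cmod (Cmult (RtoC t) x) <= Rabs t * p.
Proof.
  intros. rewrite Cmod_mult, Cmod_R. apply Rmult_le_compat_l; [apply Rabs_pos|easy].
Qed.

Lemma tail_bound_lin gamma gamma' t c c' K :
  tail_bound gamma c K -> tail_bound gamma' c' K ->
  tail_bound (fun k => Cplus (gamma k) (Cmult (RtoC t) (gamma' k))) (c + Rabs t * c') K.
Proof.
  intros H H' M N a b Hb. rewrite form_lin.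
  replace ((c + Rabs t * c') * nrm a M * nrm b N) with
    (c * nrm a M * nrm b N + Rabs t * (c' * nrm a M * nrm b N)) by ring.
  apply Cmod_plus_le; [now apply H|]. apply Cmod_scal_le. now apply H'.
Qed.

Lemma scale_zero d a n : a n = RtoC 0 -> scale d a n = RtoC 0.
Proof. intros H. unfold scale. rewrite H. ring. Qed.

Lemma tail_bound_pw gamma c eps K : 0 <= eps -> 0 <= c ->
  tail_bound gamma c K -> tail_bound (sym_mul gamma (pw eps)) c K.
Proof.
  intros He Hc H M N a b Hb. rewrite form_pw. eapply Rle_trans.
  - apply H. intros; now apply scale_zero, Hb.
  - pose proof (nrm_scale_le1 (dg eps) a M (fun n => dg_abs eps n He)).
    pose proof (nrm_scale_le1 (dg eps) b N (fun n => dg_abs eps n He)).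
    apply Rmult_le_compat; try apply nrm_nonneg; try easy.
    + apply Rmult_le_pos; [easy|apply nrm_nonneg].
    + now apply Rmult_le_compat_l.
Qed.

Lemma pw_eventually_small eps eta : 0 < eps -> 0 < eta ->
  exists K, forall n, (K <= n)%nat -> dg eps n <= eta.
Proof.
  (* [exp (- ln eta / eps)] is eta^(-1/eps), the point where n^(-eps) falls to [eta]. *)
  intros He Hn. destruct (nfloor_ex (exp (- ln eta / eps))) as [K HK].
  { left; apply exp_pos. }
  exists (S K). intros n Hn'. unfold dg, pw.
  rewrite <- (exp_ln eta Hn). apply exp_le.
  assert (- ln eta / eps <= ln (INR (n + 1))).
  { rewrite <- (ln_exp (- ln eta / eps)). apply ln_le; [apply exp_pos|].
    apply Rle_trans with (INR K + 1); [lra|]. rewrite <- S_INR. apply le_INR. lia. }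
  apply Rmult_le_compat_l with (r := eps) in H; [|lra].
  replace (eps * (- ln eta / eps)) with (- ln eta) in H by (field; lra). lra.
Qed.

Lemma pw_near_one eps0 eta k : 0 < eps0 -> 0 < eta ->
  exists eps, 0 < eps <= eps0 /\ forall l, (1 <= l <= k)%nat -> 1 - pw eps l <= eta.
Proof.
  intros He Hn. pose proof (ln_INR_nonneg k) as Hl.
  (* By exp(-t) >= 1 - t it is enough that eps ln k <= [eta]; the added 1 keeps the denominator
     positive when ln k = 0. *)
  exists (Rmin eps0 (eta / (1 + ln (INR k)))).
  assert (H0 : 0 < eta / (1 + ln (INR k))) by (apply Rdiv_lt_0_compat; lra).
  set (eps := Rmin eps0 (eta / (1 + ln (INR k)))).
  assert (Hp : 0 < eps) by (apply Rmin_glb_lt; lra).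
  repeat split; [easy|apply Rmin_l|]. intros l Hlk.
  assert (ln (INR l) <= ln (INR k)) by (apply ln_le; [apply lt_0_INR; lia|apply le_INR; lia]).
  unfold pw. pose proof (exp_ineq1_le (- eps * ln (INR l))).
  assert (eps * ln (INR l) <= eps * (1 + ln (INR k))) by (apply Rmult_le_compat_l; lra).
  assert (eps * (1 + ln (INR k)) <= eta / (1 + ln (INR k)) * (1 + ln (INR k)))
    by (apply Rmult_le_compat_r; [lra|apply Rmin_r]).
  replace (eta / (1 + ln (INR k)) * (1 + ln (INR k))) with eta in * by (field; lra). lra.
Qed.

(** The outer factor of D_eps T D_eps damps all coordinates beyond K as strongly as desired, while
    the inner one is a contraction. *)
Lemma vanishing_tail_pw gamma c eps : 0 < eps -> 0 <= c ->
  form_bound gamma c -> vanishing_tail (sym_mul gamma (pw eps)).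
Proof.
  intros He Hc H eta Heta.
  destruct (pw_eventually_small eps (eta / (1 + c)) He) as [K HK].
  { apply Rdiv_lt_0_compat; lra. }
  exists K. intros M N a b Hb. rewrite form_pw. eapply Rle_trans; [apply H|].
  pose proof (nrm_scale_le1 (dg eps) a M (fun n => dg_abs eps n (Rlt_le _ _ He))) as Ha.
  assert (Hb' : nrm (scale (dg eps) b) N <= eta / (1 + c) * nrm b N).
  { apply nrm_scale_le; [left; apply Rdiv_lt_0_compat; lra|].
    intros n _ Hn. rewrite Rabs_pos_eq by (left; apply pw_pos).
    apply HK. destruct (Nat.le_gt_cases K n); [easy|]. now contradict Hn; apply Hb. }
  pose proof (nrm_nonneg a M); pose proof (nrm_nonneg b N).
  pose proof (nrm_nonneg (scale (dg eps) a) M); pose proof (nrm_nonneg (scale (dg eps) b) N).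
  apply Rle_trans with (c * nrm a M * (eta / (1 + c) * nrm b N)).
  - apply Rmult_le_compat; try easy; [now apply Rmult_le_pos|now apply Rmult_le_compat_l].
  - replace (c * nrm a M * (eta / (1 + c) * nrm b N))
      with (eta * (nrm a M * nrm b N) * (c / (1 + c))) by (field; lra).
    assert (c / (1 + c) <= 1) by (apply (Rdiv_le_1 c (1 + c)); lra).
    assert (0 <= eta * (nrm a M * nrm b N)) by (repeat apply Rmult_le_pos; lra).
    nra.
Qed.

(** * Images of finite vectors, rows and cross terms *)

Definition image (gamma : nat -> C) (M : nat) (a : nat -> C) : nat -> C :=
  fun m => csum (fun n => Cmult (gamma ((n + 1) * (m + 1))%nat) (a n)) M.

Lemma form_image gamma M N a b :
  form gamma M N a b = csum (fun m => Cmult (image gamma M a m) (b m)) N.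
Proof.
  unfold form, image. rewrite csum_exchange. apply csum_ext; intros m _.
  rewrite Cmult_comm, <- csum_scal. apply csum_ext; intros n _. ring.
Qed.

Lemma Cmult_conj_mod z : Cmult z (Cconj z) = RtoC (Cmod z ^ 2).
Proof.
  rewrite Cmod2_alt. destruct z as [x y]. unfold Cmult, Cconj, RtoC, Re, Im; simpl.
  f_equal; ring.
Qed.

Lemma Cmod_conj z : Cmod (Cconj z) = Cmod z.
Proof. unfold Cmod, Cconj; simpl. f_equal. ring. Qed.

(* Testing the form against the conjugate of [hi K] times the image recovers the operator estimate. *)
Lemma tail_image gamma c K M N a : 0 <= c -> tail_bound gamma c K ->
  nrm (scale (hi K) (image gamma M a)) N <= c * nrm a M.
Proof.
  intros Hc H. set (y := scale (hi K) (image gamma M a)).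
  specialize (H M N a (fun m => Cconj (y m))).
  assert (E : form gamma M N a (fun m => Cconj (y m)) = RtoC (nrm2 y N)).
  { rewrite form_image. unfold nrm2. rewrite <- csum_RtoC. apply csum_ext; intros m _.
    rewrite <- Cmult_conj_mod. unfold y, scale.
    destruct (hi_cases K m) as [[_ ->]|[_ ->]]; [|now rewrite Cmult_1_l].
    rewrite !Cmult_0_l. unfold Cconj, RtoC, Cmult; simpl. f_equal; ring. }
  rewrite E in H.
  replace (nrm (fun m => Cconj (y m)) N) with (nrm y N) in H.
  2:{ unfold nrm, nrm2. f_equal. apply rsum_ext; intros. now rewrite Cmod_conj. }
  rewrite Cmod_R, Rabs_pos_eq, <- nrm_sqr in H by apply nrm2_nonneg.
  assert (H' : nrm y N ^ 2 <= c * nrm a M * nrm y N).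
  { apply H. intros m Hm. unfold y, scale. destruct (hi_cases K m) as [[_ ->]|[? _]]; [|lia].
    rewrite Cmult_0_l. unfold Cconj, RtoC; simpl. f_equal; ring. }
  pose proof (nrm_nonneg y N). pose proof (nrm_nonneg a M).
  destruct (Req_dec (nrm y N) 0) as [E0|E0]; [rewrite E0; now apply Rmult_le_pos|].
  apply Rmult_le_reg_r with (nrm y N); lra.
Qed.

Lemma image_bound gamma c M N a : 0 <= c -> form_bound gamma c ->
  nrm (image gamma M a) N <= c * nrm a M.
Proof.
  intros Hc H. rewrite <- (nrm_ext (scale (hi 0) (image gamma M a))).
  - apply tail_image; [easy|]. now apply form_bound_tail.
  - intros n _. unfold scale. destruct (hi_cases 0 n) as [[? _]|[_ ->]]; [lia|ring].
Qed.

(** A row is the image of a unit vector. Square summability of rows gives the decay of cross terms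
    and, later, convergence of the series in [Mop]. *)
Lemma row_bound gamma c n N : 0 <= c -> form_bound gamma c ->
  nrm (fun m => gamma ((n + 1) * (m + 1))%nat) N <= c.
Proof.
  intros Hc H. set (d := fun k => if Nat.eqb k n then RtoC 1 else RtoC 0).
  assert (Hd : nrm d (S n) = 1).
  { unfold nrm, nrm2. simpl rsum. rewrite rsum_zero.
    - unfold d. rewrite Nat.eqb_refl, Cmod_1, Rplus_0_l, !Rmult_1_l. apply sqrt_1.
    - intros k Hk. unfold d. destruct (Nat.eqb_spec k n); [lia|]. rewrite Cmod_0; ring. }
  pose proof (image_bound gamma c (S n) N d Hc H) as HB. rewrite Hd, Rmult_1_r in HB.
  rewrite <- (nrm_ext (image gamma (S n) d)); [easy|].
  intros m _. unfold image. simpl csum. rewrite csum_zero.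
  - unfold d. rewrite Nat.eqb_refl. ring.
  - intros k Hk. unfold d. destruct (Nat.eqb_spec k n); [lia|]. ring.
Qed.

Lemma bounded_nonneg_sum_tail (f : nat -> R) c eta : (forall n, 0 <= f n) ->
  (forall N, rsum f N <= c) -> 0 < eta -> exists K, forall N, rsum f N <= rsum f K + eta.
Proof.
  intros Hf Hc He.
  destruct (completeness (fun x => exists N, x = rsum f N)) as [l [Hl1 Hl2]].
  - exists c. intros x [N ->]. apply Hc.
  - exists (rsum f 0). now exists 0%nat.
  - destruct (classic (exists K, l - eta < rsum f K)) as [[K HK]|Hn].
    + exists K. intros N. specialize (Hl1 (rsum f N) (ex_intro _ N eq_refl)). lra.
    + exfalso. assert (l <= l - eta); [|lra]. apply Hl2. intros x [N ->].
      apply Rnot_lt_le. intros HN. apply Hn. now exists N.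
Qed.

Lemma nrm2_hi a K N : nrm2 (scale (hi K) a) N = nrm2 a (max K N) - nrm2 a K.
Proof.
  destruct (Nat.le_gt_cases N K) as [H|H].
  - rewrite Nat.max_l by easy. rewrite nrm2_scale, rsum_zero; [ring|].
    intros n Hn. destruct (hi_cases K n) as [[_ ->]|[? _]]; [ring|lia].
  - rewrite Nat.max_r by lia.
    assert (E : nrm2 a K = nrm2 (scale (lo K) a) N).
    { rewrite nrm2_scale. rewrite (rsum_extend _ K N); [|lia|].
      - apply rsum_ext; intros n Hn. destruct (lo_cases K n) as [[_ ->]|[? _]]; [ring|lia].
      - intros n Hn. destruct (lo_cases K n) as [[? _]|[_ ->]]; [lia|ring]. }
    rewrite E, !nrm2_scale. unfold nrm2.
    apply Rplus_eq_reg_r with (rsum (fun n => lo K n ^ 2 * Cmod (a n) ^ 2) N).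
    rewrite <- rsum_plus. unfold Rminus. rewrite Rplus_assoc, Rplus_opp_l, Rplus_0_r.
    apply rsum_ext; intros n _.
    destruct (lo_cases K n) as [[? ->]|[? ->]], (hi_cases K n) as [[? ->]|[? ->]]; try lia; ring.
Qed.

Lemma bounded_nrm_tail a c eta : (forall N, nrm a N <= c) -> 0 < eta ->
  exists K, forall K' N, (K <= K')%nat -> nrm (scale (hi K') a) N <= eta.
Proof.
  intros H He.
  destruct (bounded_nonneg_sum_tail (fun n => Cmod (a n) ^ 2) (c ^ 2) (eta ^ 2)) as [K HK].
  - intros; apply pow2_ge_0.
  - intros N. fold (nrm2 a N). rewrite <- nrm_sqr. apply pow_incr.
    split; [apply nrm_nonneg|apply H].
  - now apply pow_lt.
  - exists K. intros K' N HKK. apply nrm_le_of_sqr; [lra|]. rewrite nrm2_hi.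
    specialize (HK (max K' N)). fold (nrm2 a (max K' N)) (nrm2 a K) in HK.
    assert (nrm2 a K <= nrm2 a K') by (apply rsum_mono; [intros; apply pow2_ge_0|easy]). lra.
Qed.

(** Only the finitely many rows n < K meet [a], and each is square summable, so beyond a common K'
    all of them are small. *)
Lemma cross_small gamma c K eta : 0 <= c -> form_bound gamma c -> 0 < eta ->
  exists K', forall M N a b, (forall n, (K <= n)%nat -> a n = RtoC 0) ->
    (forall m, (m < K')%nat -> b m = RtoC 0) ->
    Cmod (form gamma M N a b) <= eta * nrm a M * nrm b N.
Proof.
  intros Hc H.
  (* Bounding row by row loses a factor K, which is recovered by dividing [eta] by 1 + K. *)
  enough (Hs : forall eta, 0 < eta -> exists K', forall M N a b,
    (forall n, (K <= n)%nat -> a n = RtoC 0) -> (forall m, (m < K')%nat -> b m = RtoC 0) ->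
    Cmod (form gamma M N a b) <= INR K * (eta * nrm a M * nrm b N)).
  { intros He. pose proof (pos_INR K).
    destruct (Hs (eta / (1 + INR K))) as [K' HK']; [apply Rdiv_lt_0_compat; lra|].
    exists K'. intros M N a b Ha Hb. eapply Rle_trans; [now apply HK'|].
    pose proof (nrm_nonneg a M); pose proof (nrm_nonneg b N).
    replace (INR K * (eta / (1 + INR K) * nrm a M * nrm b N))
      with (eta * nrm a M * nrm b N * (INR K / (1 + INR K))) by (field; lra).
    assert (INR K / (1 + INR K) <= 1) by (apply (Rdiv_le_1 (INR K) (1 + INR K)); lra).
    assert (0 <= eta * nrm a M * nrm b N) by (repeat apply Rmult_le_pos; lra). nra. }
  clear eta. intros eta He.
  assert (Hrow : exists K', forall n N, (n < K)%nat ->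
    nrm (scale (hi K') (fun m => gamma ((n + 1) * (m + 1))%nat)) N <= eta).
  { induction K as [|K IH].
    - exists 0%nat. intros; lia.
    - destruct IH as [K1 H1].
      destruct (bounded_nrm_tail (fun m => gamma ((K + 1) * (m + 1))%nat) c eta) as [K2 H2];
        [intros; now apply row_bound|easy|].
      exists (max K1 K2). intros n N Hn.
      destruct (Nat.eq_dec n K) as [->|Hne]; [apply H2; lia|].
      eapply Rle_trans; [|apply (H1 n N); lia].
      apply sqrt_le_1_alt. rewrite !nrm2_scale. apply rsum_le. intros m _.
      apply Rmult_le_compat_r; [apply pow2_ge_0|].
      destruct (hi_cases (max K1 K2) m) as [[? ->]|[? ->]], (hi_cases K1 m) as [[? ->]|[? ->]];
        try lia; lra. }
  destruct Hrow as [K' HK']. exists K'. intros M N a b Ha Hb.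
  unfold form. eapply Rle_trans; [apply Cmod_csum|].
  apply Rle_trans with (rsum (fun n => if Nat.ltb n K then eta * nrm a M * nrm b N else 0) M).
  - apply rsum_le; intros n Hn. destruct (Nat.ltb_spec n K) as [Hl|Hl].
    + rewrite (csum_ext _ (fun m => Cmult (a n)
        (Cmult (scale (hi K') (fun m => gamma ((n + 1) * (m + 1))%nat) m) (b m)))).
      2:{ intros m _. unfold scale. destruct (hi_cases K' m) as [[? ->]|[_ ->]]; [|ring].
          rewrite Hb by easy. ring. }
      rewrite csum_scal, Cmod_mult.
      replace (eta * nrm a M * nrm b N) with (nrm a M * (eta * nrm b N)) by ring.
      apply Rmult_le_compat; try apply Cmod_ge_0; [now apply nrm_coord|].
      eapply Rle_trans; [apply csum_CS|].
      apply Rmult_le_compat_r; [apply nrm_nonneg|]. now apply HK'.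
    + rewrite csum_zero, Cmod_0; [lra|]. intros m _. rewrite Ha by easy. ring.
  - set (t := eta * nrm a M * nrm b N).
    assert (0 <= t) by (repeat apply Rmult_le_pos; try apply nrm_nonneg; lra).
    eapply Rle_trans; [apply rsum_mono with (N' := max M K); [|lia]|].
    { intros n. destruct (Nat.ltb n K); lra. }
    rewrite (rsum_extend _ K); [|lia|].
    + rewrite (rsum_ext _ (fun _ => t)); [rewrite rsum_const; lra|].
      intros n Hn. now destruct (Nat.ltb_spec n K); [|lia].
    + intros n Hn. now destruct (Nat.ltb_spec n K); [lia|].
Qed.

(** * The basic inequality *)

Lemma scale_vadd d x y : scale d (vadd x y) = vadd (scale d x) (scale d y).
Proof. extensionality n. unfold scale, vadd. ring. Qed.

Lemma vec_split_eq a N N' :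
  a = vadd (scale (mid N N') a) (vadd (scale (lo N) a) (scale (hi N') a)).
Proof.
  extensionality n. rewrite (vec_split a N N' n) at 1. unfold vadd. ring.
Qed.

Lemma diag_split d x : x = vadd (scale d x) (scale (fun n => 1 - d n) x).
Proof. extensionality n. unfold vadd, scale. rewrite RtoC_minus. ring. Qed.

(** Cauchy-Schwarz for the norms of orthogonal pieces. Through it the two diagonal blocks contribute
    the maximum of their constants and not the sum. *)
Lemma pair_CS p1 p2 p3 p q1 q2 q3 q : 0 <= p -> 0 <= q ->
  p1 ^ 2 + p2 ^ 2 + p3 ^ 2 = p ^ 2 -> q1 ^ 2 + q2 ^ 2 + q3 ^ 2 = q ^ 2 ->
  p1 * q1 + p3 * q3 <= p * q.
Proof.
  intros Hp Hq H1 H2.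
  destruct (Rle_lt_dec (p1 * q1 + p3 * q3) 0) as [H|H]; [pose proof (Rmult_le_pos _ _ Hp Hq); lra|].
  apply Rsqr_incr_0_var; [|now apply Rmult_le_pos].
  unfold Rsqr. replace (p * q * (p * q)) with (p ^ 2 * q ^ 2) by ring. rewrite <- H1, <- H2.
  pose proof (pow2_ge_0 (p1 * q3 - p3 * q1)).
  pose proof (pow2_ge_0 (p2 * q1)); pose proof (pow2_ge_0 (p2 * q2));
  pose proof (pow2_ge_0 (p2 * q3)); pose proof (pow2_ge_0 (p1 * q2));
  pose proof (pow2_ge_0 (p3 * q2)). nra.
Qed.

Lemma mult3_le k x y u v w : 0 <= k -> 0 <= x -> 0 <= y -> x <= u * v -> y <= w -> 0 <= u -> 0 <= v ->
  k * x * y <= k * u * (v * w).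
Proof.
  intros. replace (k * u * (v * w)) with (k * (u * v) * w) by ring.
  apply Rmult_le_compat; auto; [now apply Rmult_le_pos|now apply Rmult_le_compat_l].
Qed.

(* Below [N] the diagonal operator is close to the identity and the new symbol acts like [X];
   above [N'] it is close to zero and the new symbol acts like [X + b alpha]. *)
Lemma block_estimate (alpha X : nat -> C) (C c c2 b eps eta : R) (N N' : nat) :
  0 <= C -> 0 <= c -> 0 <= c2 -> 0 <= b <= 1 -> 0 <= eps -> 0 <= eta <= 1 -> (N <= N')%nat ->
  form_bound alpha C -> form_bound X c ->
  tail_bound (fun k => Cplus (X k) (Cmult (RtoC b) (alpha k))) c2 N' ->
  (forall n, (n < N)%nat -> 1 - dg eps n <= eta) ->
  (forall n, (N' <= n)%nat -> dg eps n <= eta) ->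
  (forall M L x y, (forall n, (N <= n)%nat -> x n = RtoC 0) ->
     (forall m, (m < N')%nat -> y m = RtoC 0) ->
     Cmod (form (fun k => Cplus (X k) (Cmult (RtoC b) (alpha k))) M L x y)
     <= eta * nrm x M * nrm y L) ->
  forall M L x y,
  Cmod (form (fun k => Cplus (X k) (Cmult (RtoC b)
     (Cplus (alpha k) (Cmult (RtoC (-1)) (sym_mul alpha (pw eps) k))))) M L x y)
  <= (Rmax c c2 + (2 + 5 * C) * eta) * (nrm x M * nrm y L)
     + 2 * (c + 2 * C) * (nrm (scale (mid N N') x) M * nrm y L
                          + nrm x M * nrm (scale (mid N N') y) L).
Proof.
  intros HC Hc Hc2 Hb He Heta HN Halpha HX Htau Hlo Hhi Hcross M L x y.
  set (D := scale (dg eps)).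
  set (Y := fun u v => Cplus (form X M L u v) (Cmult (RtoC b)
     (Cplus (form alpha M L u v) (Cmult (RtoC (-1)) (form alpha M L (D u) (D v)))))).
  rewrite form_lin, form_lin, form_pw. fold D. change (Cmod (Y x y) <=
    (Rmax c c2 + (2 + 5 * C) * eta) * (nrm x M * nrm y L)
     + 2 * (c + 2 * C) * (nrm (scale (mid N N') x) M * nrm y L
                          + nrm x M * nrm (scale (mid N N') y) L)).
  assert (Yl : forall u u' v, Y (vadd u u') v = Cplus (Y u v) (Y u' v)).
  { intros. unfold Y, D. rewrite scale_vadd, !form_add_l. ring. }
  assert (Yr : forall u v v', Y u (vadd v v') = Cplus (Y u v) (Y u v')).
  { intros. unfold Y, D. rewrite scale_vadd, !form_add_r. ring. }
  assert (HbA : Rabs b <= 1) by (apply Rabs_le; lra).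
  assert (HD1 : forall u K, nrm (D u) K <= nrm u K).
  { intros. apply nrm_scale_le1. intros; now apply dg_abs. }
  assert (Hscal : forall t z p, 0 <= p -> Rabs t <= 1 -> Cmod z <= p -> Cmod (Cmult (RtoC t) z) <= p).
  { intros t z p Hp Ht Hz. eapply Rle_trans; [apply Cmod_scal_le, Hz|].
    rewrite <- (Rmult_1_l p) at 2. now apply Rmult_le_compat_r. }
  assert (Hm1 : Rabs (-1) <= 1) by (apply Rabs_le; lra).
  assert (Halg : forall u v, 0 <= C * nrm u M * nrm v L).
  { intros. repeat apply Rmult_le_pos; auto using nrm_nonneg. }
  assert (HYb : forall u v, Cmod (Y u v) <= (c + 2 * C) * (nrm u M * nrm v L)).
  { intros u v.
    replace ((c + 2 * C) * (nrm u M * nrm v L)) with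
      (c * nrm u M * nrm v L + (C * nrm u M * nrm v L + C * nrm u M * nrm v L)) by ring.
    pose proof (Halg u v).
    apply Cmod_plus_le; [apply HX|]. apply Hscal; [lra|easy|].
    apply Cmod_plus_le; [apply Halpha|]. apply Hscal; [lra|easy|].
    eapply Rle_trans; [apply Halpha|]. apply Rmult_le_compat; auto using nrm_nonneg.
    - apply Rmult_le_pos; auto using nrm_nonneg.
    - now apply Rmult_le_compat_l. }
  assert (Hlower : forall u K, (forall n, (N <= n)%nat -> u n = RtoC 0) ->
     nrm (scale (fun n => 1 - dg eps n) u) K <= eta * nrm u K).
  { intros u K Hu. apply nrm_scale_le; [lra|]. intros n _ Hn.
    pose proof (dg_abs eps n He) as Hd. apply Rabs_le_between in Hd.
    rewrite Rabs_pos_eq by lra. apply Hlo.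
    destruct (Nat.le_gt_cases N n); [|easy]. now contradict Hn; apply Hu. }
  assert (Hupper : forall u K, (forall n, (n < N')%nat -> u n = RtoC 0) ->
     nrm (D u) K <= eta * nrm u K).
  { intros u K Hu. apply nrm_scale_le; [lra|]. intros n _ Hn.
    rewrite Rabs_pos_eq by (left; apply pw_pos). apply Hhi.
    destruct (Nat.le_gt_cases N' n); [easy|]. now contradict Hn; apply Hu. }
  (* Where D is small, X + b T is grouped together and only - b D T D is left as an error. *)
  assert (HYtau : forall u v, Y u v = Cplus
    (form (fun k => Cplus (X k) (Cmult (RtoC b) (alpha k))) M L u v)
    (Cmult (RtoC b) (Cmult (RtoC (-1)) (form alpha M L (D u) (D v))))).
  { intros. unfold Y. rewrite form_lin. ring. }
  assert (HYll : forall u v, (forall n, (N <= n)%nat -> u n = RtoC 0) ->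
     (forall n, (N <= n)%nat -> v n = RtoC 0) ->
     Cmod (Y u v) <= c * (nrm u M * nrm v L) + 2 * C * eta * (nrm u M * nrm v L)).
  { intros u v Hu Hv. unfold Y.
    rewrite (diag_split (dg eps) v) at 2. fold (D v). set (v' := scale (fun n => 1 - dg eps n) v).
    rewrite form_add_r. rewrite (diag_split (dg eps) u) at 2. fold (D u).
    set (u' := scale (fun n => 1 - dg eps n) u). rewrite form_add_l.
    replace (c * (nrm u M * nrm v L) + 2 * C * eta * (nrm u M * nrm v L)) with
      (c * nrm u M * nrm v L + (C * eta * nrm u M * nrm v L + C * eta * nrm u M * nrm v L)) by ring.
    pose proof (nrm_nonneg u M); pose proof (nrm_nonneg v L).
    assert (0 <= C * eta * nrm u M * nrm v L) by (repeat apply Rmult_le_pos; lra).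
    apply Cmod_plus_le; [apply HX|]. apply Hscal; [lra|easy|].
    (* T(u, v) - T(Du, Dv) = T((1 - D)u, Dv) + T(u, (1 - D)v), and 1 - D is at most [eta] on the low
       block. *)
    match goal with |- Cmod ?z <= _ => replace z with
      (Cplus (form alpha M L u' (D v)) (form alpha M L u v')) by ring end.
    apply Cmod_plus_le; (eapply Rle_trans; [apply Halpha|]).
    - replace (C * eta * nrm u M * nrm v L) with (C * eta * (nrm u M * nrm v L)) by ring.
      apply mult3_le; auto using nrm_nonneg; try lra. now apply Hlower.
    - replace (C * eta * nrm u M * nrm v L) with (C * nrm u M * (eta * nrm v L)) by ring.
      apply Rmult_le_compat; auto using nrm_nonneg; try lra; [now apply Rmult_le_pos|].
      now apply Hlower. }
  assert (HDD : forall u v, (forall n, (n < N')%nat -> v n = RtoC 0) ->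
    Cmod (Cmult (RtoC b) (Cmult (RtoC (-1)) (form alpha M L (D u) (D v))))
    <= C * eta * (nrm u M * nrm v L)).
  { intros u v Hv. pose proof (nrm_nonneg u M); pose proof (nrm_nonneg v L).
    assert (0 <= C * eta * (nrm u M * nrm v L)) by (repeat apply Rmult_le_pos; lra).
    apply Hscal; [easy|easy|]. apply Hscal; [easy|easy|].
    eapply Rle_trans; [apply Halpha|].
    replace (C * eta * (nrm u M * nrm v L)) with (C * nrm u M * (eta * nrm v L)) by ring.
    apply Rmult_le_compat; auto using nrm_nonneg.
    - apply Rmult_le_pos; auto using nrm_nonneg.
    - now apply Rmult_le_compat_l. }
  assert (HDD' : forall u v, (forall n, (n < N')%nat -> u n = RtoC 0) ->
    Cmod (Cmult (RtoC b) (Cmult (RtoC (-1)) (form alpha M L (D u) (D v))))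
    <= C * eta * (nrm u M * nrm v L)).
  { intros u v Hu. pose proof (nrm_nonneg u M); pose proof (nrm_nonneg v L).
    assert (0 <= C * eta * (nrm u M * nrm v L)) by (repeat apply Rmult_le_pos; lra).
    apply Hscal; [easy|easy|]. apply Hscal; [easy|easy|].
    eapply Rle_trans; [apply Halpha|].
    apply mult3_le; auto using nrm_nonneg; lra. }
  set (x1 := scale (lo N) x); set (x2 := scale (mid N N') x); set (x3 := scale (hi N') x).
  set (y1 := scale (lo N) y); set (y2 := scale (mid N N') y); set (y3 := scale (hi N') y).
  assert (Hlow : forall u n, (N <= n)%nat -> scale (lo N) u n = RtoC 0).
  { intros u n Hn. unfold scale. destruct (lo_cases N n) as [[? _]|[_ ->]]; [lia|ring]. }
  assert (Hhigh : forall u n, (n < N')%nat -> scale (hi N') u n = RtoC 0).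
  { intros u n Hn. unfold scale. destruct (hi_cases N' n) as [[_ ->]|[? _]]; [ring|lia]. }
  (* The transition part is split off first, [x2] against all of [y] and then [y2] against the rest
     of [x]; four corners remain. *)
  assert (E : Y x y = Cplus (Cplus (Y x2 y) (Cplus (Y x1 y2) (Y x3 y2)))
     (Cplus (Cplus (Y x1 y1) (Y x3 y3)) (Cplus (Y x1 y3) (Y x3 y1)))).
  { rewrite (vec_split_eq x N N') at 1. fold x1 x2 x3. rewrite !Yl.
    rewrite (vec_split_eq y N N') at 2 3. fold y1 y2 y3. rewrite !Yr. ring. }
  rewrite E. clear E.
  pose proof (HYb x2 y) as E1. pose proof (HYb x1 y2) as E2. pose proof (HYb x3 y2) as E3.
  pose proof (HYll x1 y1 (Hlow x) (Hlow y)) as E4.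
  assert (E5 : Cmod (Y x3 y3) <= c2 * nrm x3 M * nrm y3 L + C * eta * (nrm x3 M * nrm y3 L)).
  { rewrite HYtau. apply Cmod_plus_le; [apply Htau; apply Hhigh|apply HDD; apply Hhigh]. }
  assert (E6 : Cmod (Y x1 y3) <= eta * nrm x1 M * nrm y3 L + C * eta * (nrm x1 M * nrm y3 L)).
  { rewrite HYtau. apply Cmod_plus_le; [apply Hcross; [apply Hlow|apply Hhigh]|apply HDD; apply Hhigh]. }
  (* [Hcross] wants the low vector first; symmetry of the form supplies the opposite corner. *)
  assert (E7 : Cmod (Y x3 y1) <= eta * nrm y1 L * nrm x3 M + C * eta * (nrm x3 M * nrm y1 L)).
  { rewrite HYtau. apply Cmod_plus_le; [|apply HDD'; apply Hhigh].
    rewrite form_sym. apply Hcross; [apply Hlow|apply Hhigh]. }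
  pose proof (nrm2_split x N N' M HN) as Px. pose proof (nrm2_split y N N' L HN) as Py.
  fold x1 x2 x3 in Px. fold y1 y2 y3 in Py. rewrite <- !nrm_sqr in Px, Py.
  assert (Hx1 : nrm x1 M <= nrm x M) by (apply nrm_scale_le1, lo_abs).
  assert (Hx3 : nrm x3 M <= nrm x M) by (apply nrm_scale_le1, hi_abs).
  assert (Hy1 : nrm y1 L <= nrm y L) by (apply nrm_scale_le1, lo_abs).
  assert (Hy3 : nrm y3 L <= nrm y L) by (apply nrm_scale_le1, hi_abs).
  pose proof (nrm_nonneg x1 M); pose proof (nrm_nonneg x2 M); pose proof (nrm_nonneg x3 M);
  pose proof (nrm_nonneg y1 L); pose proof (nrm_nonneg y2 L); pose proof (nrm_nonneg y3 L);
  pose proof (nrm_nonneg x M); pose proof (nrm_nonneg y L).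
  pose proof (pair_CS _ _ _ _ _ _ _ _ H5 H6 Px Py) as PCS.
  set (p1 := nrm x1 M) in *; set (p2 := nrm x2 M) in *; set (p3 := nrm x3 M) in *;
  set (q1 := nrm y1 L) in *; set (q2 := nrm y2 L) in *; set (q3 := nrm y3 L) in *;
  set (p := nrm x M) in *; set (q := nrm y L) in *.
  eapply Rle_trans.
  { exact (Cmod_plus_le _ _ _ _ (Cmod_plus_le _ _ _ _ E1 (Cmod_plus_le _ _ _ _ E2 E3))
      (Cmod_plus_le _ _ _ _ (Cmod_plus_le _ _ _ _ E4 E5) (Cmod_plus_le _ _ _ _ E6 E7))). }
  assert (HK : 0 <= c + 2 * C) by lra. assert (HE : 0 <= C * eta) by (apply Rmult_le_pos; lra).
  assert (F1 : p1 * q2 <= p * q2) by (now apply Rmult_le_compat_r).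
  assert (F2 : p3 * q2 <= p * q2) by (now apply Rmult_le_compat_r).
  assert (F3 : p1 * q1 <= p * q) by (now apply Rmult_le_compat).
  assert (F4 : p3 * q3 <= p * q) by (now apply Rmult_le_compat).
  assert (F5 : p1 * q3 <= p * q) by (now apply Rmult_le_compat).
  assert (F6 : p3 * q1 <= p * q) by (now apply Rmult_le_compat).
  assert (F7 : 0 <= p2 * q) by (now apply Rmult_le_pos).
  pose proof (Rmult_le_compat_l _ _ _ HK F1). pose proof (Rmult_le_compat_l _ _ _ HK F2).
  pose proof (Rmult_le_pos _ _ HK F7).
  pose proof (Rmult_le_compat_l _ _ _ HE F3). pose proof (Rmult_le_compat_l _ _ _ HE F4).
  pose proof (Rmult_le_compat_l _ _ _ HE F5). pose proof (Rmult_le_compat_l _ _ _ HE F6).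
  pose proof (Rmult_le_compat_l _ _ _ (proj1 Heta) F5).
  pose proof (Rmult_le_compat_l _ _ _ (proj1 Heta) F6).
  assert (G1 : c * (p1 * q1) <= Rmax c c2 * (p1 * q1))
    by (apply Rmult_le_compat_r; [now apply Rmult_le_pos|apply Rmax_l]).
  assert (G2 : c2 * (p3 * q3) <= Rmax c c2 * (p3 * q3))
    by (apply Rmult_le_compat_r; [now apply Rmult_le_pos|apply Rmax_r]).
  assert (HM : 0 <= Rmax c c2) by (eapply Rle_trans; [exact Hc|apply Rmax_l]).
  pose proof (Rmult_le_compat_l _ _ _ HM PCS) as G3.
  set (m := Rmax c c2) in *.
  (* [E1], [E2], [E3] give the transition terms. [E4] to [E7] carry 2C, C, 1 + C and 1 + C times
     [eta], in all 2 + 5C; the main terms of [E4] and [E5] combine by [PCS]. *)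
  lra.
Qed.

(** * Averages of the multipliers n^(-eps) *)

Lemma form_csum (gamma : nat -> nat -> C) K M N a b :
  form (fun k => csum (fun i => gamma i k) K) M N a b
  = csum (fun i => form (gamma i) M N a b) K.
Proof.
  induction K as [|K IH]; simpl.
  - unfold form. apply csum_zero; intros n _. apply csum_zero; intros m _. ring.
  - rewrite <- IH, <- (Cmult_1_l (form (gamma K) M N a b)), <- form_lin.
    apply form_ext; intros; try easy. ring.
Qed.

Lemma tail_bound_scal gamma t c K :
  tail_bound gamma c K -> tail_bound (fun k => Cmult (RtoC t) (gamma k)) (Rabs t * c) K.
Proof.
  intros H M N a b Hb.
  replace (form (fun k => Cmult (RtoC t) (gamma k)) M N a b)
    with (Cmult (RtoC t) (form gamma M N a b)).
  - replace (Rabs t * c * nrm a M * nrm b N) with (Rabs t * (c * nrm a M * nrm b N)) by ring.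
    apply Cmod_scal_le. now apply H.
  - unfold form. rewrite <- csum_scal. apply csum_ext; intros n _.
    rewrite <- csum_scal. apply csum_ext; intros m _. ring.
Qed.

Definition avg_pw (e : nat -> R) (K : nat) (k : nat) : R := rsum (fun i => pw (e i) k) K / INR K.

(** n^(-eps) decreases in eps and is below 1 for n >= 2. Both bounds are passed on to the final
    multiplier, where they separate two minimizers. *)
Lemma avg_pw_bounds e K eps0 k : (0 < K)%nat -> (forall i, 0 < e i <= eps0) ->
  pw eps0 k <= avg_pw e K k <= 1 /\ ((2 <= k)%nat -> avg_pw e K k < 1).
Proof.
  intros HK He. assert (HK' : 0 < INR K) by (apply lt_0_INR; lia).
  assert (Hk1 : forall f t, (forall i, f i <= t) -> rsum f K <= INR K * t).
  { intros f t Hf. rewrite <- rsum_const. apply rsum_le; auto. }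
  assert (Hle : avg_pw e K k <= 1).
  { apply (Rdiv_le_1 _ (INR K) HK'). rewrite <- (Rmult_1_r (INR K)). apply Hk1.
    intros i. apply pw_le1. apply Rlt_le, He. }
  repeat split; [|easy|].
  - apply (Rle_div_r _ _ _ HK'). rewrite Rmult_comm, <- rsum_const. apply rsum_le.
    intros i _. apply pw_antimono, He.
  - intros Hk. apply (Rlt_div_l _ _ _ HK'). rewrite Rmult_1_l.
    destruct K as [|K]; [lia|]. rewrite S_INR. simpl rsum.
    apply Rplus_le_lt_compat; [|apply pw_lt1; [apply He|easy]].
    rewrite <- (Rmult_1_r (INR K)), <- rsum_const. apply rsum_le.
    intros i _. apply pw_le1, Rlt_le, He.
Qed.

Lemma tail_bound_csum (gamma : nat -> nat -> C) c n K :
  (forall i, tail_bound (gamma i) c K) ->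
  tail_bound (fun k => csum (fun i => gamma i k) n) (INR n * c) K.
Proof.
  intros H M N a b Hb. rewrite form_csum. eapply Rle_trans; [apply Cmod_csum|].
  replace (INR n * c * nrm a M * nrm b N) with (INR n * (c * nrm a M * nrm b N)) by ring.
  rewrite <- rsum_const. apply rsum_le. intros i _. now apply H.
Qed.

Lemma sym_mul_avg_eq alpha e K k :
  Cmult (RtoC (/ INR K)) (csum (fun i => sym_mul alpha (pw (e i)) k) K)
  = sym_mul alpha (avg_pw e K) k.
Proof.
  unfold sym_mul, avg_pw, Rdiv.
  rewrite (csum_scal (alpha k) (fun i => RtoC (pw (e i) k))), csum_RtoC, RtoC_mult. ring.
Qed.

Lemma form_bound_avg alpha C e K : 0 <= C -> (0 < K)%nat -> (forall i, 0 < e i) ->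
  form_bound alpha C -> form_bound (sym_mul alpha (avg_pw e K)) C.
Proof.
  intros HC HK He H. assert (HK' : 0 < INR K) by (apply lt_0_INR; lia).
  apply form_bound_tail.
  eapply tail_bound_ext; [intros k _; apply sym_mul_avg_eq|].
  replace C with (Rabs (/ INR K) * (INR K * C)).
  - apply tail_bound_scal, tail_bound_csum. intros i.
    apply tail_bound_pw; [apply Rlt_le, He|easy|]. now apply form_bound_tail.
  - rewrite Rabs_pos_eq by (left; now apply Rinv_0_lt_compat). field. lra.
Qed.

Lemma vanishing_tail_lin gamma gamma' t : vanishing_tail gamma -> vanishing_tail gamma' ->
  vanishing_tail (fun k => Cplus (gamma k) (Cmult (RtoC t) (gamma' k))).
Proof.
  intros H H' eps He. pose proof (Rabs_pos t).
  destruct (H (eps / 2)) as [K HK]; [lra|].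
  destruct (H' (eps / 2 / (1 + Rabs t))) as [K' HK']; [apply Rdiv_lt_0_compat; lra|].
  exists (max K K'). eapply tail_bound_le.
  2:{ apply tail_bound_lin; eapply tail_bound_mono; [|exact HK| |exact HK']; lia. }
  replace (Rabs t * (eps / 2 / (1 + Rabs t))) with (eps / 2 * (Rabs t / (1 + Rabs t))) by (field; lra).
  assert (Rabs t / (1 + Rabs t) <= 1) by (apply (Rdiv_le_1 (Rabs t) (1 + Rabs t)); lra). nra.
Qed.

Lemma vanishing_tail_ext gamma gamma' : (forall k, (1 <= k)%nat -> gamma k = gamma' k) ->
  vanishing_tail gamma -> vanishing_tail gamma'.
Proof.
  intros E H eps He. destruct (H eps He) as [K HK]. exists K. now apply tail_bound_ext with gamma.
Qed.

Lemma vanishing_tail_zero gamma : (forall k, (1 <= k)%nat -> gamma k = RtoC 0) ->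
  vanishing_tail gamma.
Proof.
  intros E eps He. exists 0%nat. intros M N a b _.
  unfold form. rewrite csum_zero, Cmod_0.
  - repeat apply Rmult_le_pos; try apply nrm_nonneg; lra.
  - intros n _. apply csum_zero. intros m _. rewrite E by nia. ring.
Qed.

Lemma vanishing_tail_avg alpha C e K : 0 <= C -> (forall i, 0 < e i) ->
  form_bound alpha C -> vanishing_tail (sym_mul alpha (avg_pw e K)).
Proof.
  intros HC He H.
  assert (Hs : forall n, vanishing_tail (fun k => csum (fun i => sym_mul alpha (pw (e i)) k) n)).
  { induction n as [|n IH]; [now apply vanishing_tail_zero|].
    eapply vanishing_tail_ext.
    2:{ apply (vanishing_tail_lin _ (sym_mul alpha (pw (e n))) 1 IH). apply (vanishing_tail_pw alpha C (e n)); auto. }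
    intros k _. simpl. ring. }
  eapply vanishing_tail_ext.
  2:{ apply (vanishing_tail_lin (fun _ => RtoC 0) (fun k => csum (fun i => sym_mul alpha (pw (e i)) k) K) (/ INR K)); [|apply Hs].
      now apply vanishing_tail_zero. }
  intros k _. cbv beta. rewrite Cplus_0_l. apply sym_mul_avg_eq.
Qed.

(** Cauchy-Schwarz over the K blocks gives sqrt K where the triangle inequality gives K; after
    division by K the transition cost tends to 0. *)
Lemma sum_mid_nrm (Nb : nat -> nat) a M K : (forall i, (Nb i <= Nb (S i))%nat) ->
  rsum (fun i => nrm (scale (mid (Nb i) (Nb (S i))) a) M) K <= sqrt (INR K) * nrm a M.
Proof.
  intros H.
  pose proof (rsum_CS (fun _ => 1) (fun i => nrm (scale (mid (Nb i) (Nb (S i))) a) M) K) as HCS.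
  apply Rle_trans with (1 := Rle_abs _) in HCS.
  rewrite (rsum_ext _ (fun i => nrm (scale (mid (Nb i) (Nb (S i))) a) M)) in HCS
    by (intros; apply Rmult_1_l).
  eapply Rle_trans; [exact HCS|].
  rewrite (rsum_ext (fun _ => 1 ^ 2) (fun _ => 1)) by (intros; ring).
  rewrite rsum_const, Rmult_1_r. apply Rmult_le_compat_l; [apply sqrt_pos|].
  apply sqrt_le_1_alt.
  rewrite (rsum_ext _ (fun i => nrm2 (scale (mid (Nb i) (Nb (S i))) a) M))
    by (intros; apply nrm_sqr).
  now apply nrm2_mid_sum.
Qed.

(* Averaging over sparse blocks makes the contribution of the transition zones negligible. *)
Lemma basic_inequality (alpha X : nat -> C) (C c c2 b eps0 delta : R) (N0 : nat) :
  0 <= C -> 0 <= c -> 0 <= c2 -> 0 <= b <= 1 -> 0 < eps0 -> 0 < delta ->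
  form_bound alpha C -> form_bound X c ->
  tail_bound (fun k => Cplus (X k) (Cmult (RtoC b) (alpha k))) c2 N0 ->
  exists e K, (0 < K)%nat /\ (forall i, 0 < e i <= eps0) /\
    form_bound (fun k => Cplus (X k) (Cmult (RtoC b)
      (Cplus (alpha k) (Cmult (RtoC (-1)) (sym_mul alpha (avg_pw e K) k))))) (Rmax c c2 + delta).
Proof.
  intros HC Hc Hc2 Hb Heps0 Hdelta Halpha HX Htau.
  set (tau := fun k => Cplus (X k) (Cmult (RtoC b) (alpha k))) in *.
  assert (Htaub : form_bound tau (c + Rabs b * C)).
  { apply form_bound_tail, tail_bound_lin; now apply form_bound_tail. }
  assert (Htc : 0 <= c + Rabs b * C) by (pose proof (Rabs_pos b); nra).
  (* Half of [delta] pays for the term (2 + 5C) [eta] of each block, the other half for the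
     transition zones. *)
  set (eta := Rmin 1 (delta / (2 * (2 + 5 * C)))).
  assert (Heta : 0 < eta) by (apply Rmin_glb_lt; [lra|apply Rdiv_lt_0_compat; lra]).
  assert (Heta1 : eta <= 1) by apply Rmin_l.
  assert (Heta2 : (2 + 5 * C) * eta <= delta / 2).
  { apply Rle_trans with ((2 + 5 * C) * (delta / (2 * (2 + 5 * C)))).
    - apply Rmult_le_compat_l; [lra|apply Rmin_r].
    - right; field; lra. }
  (* The order of choice matters: first an exponent so small that the diagonal is near 1 below N,
     then an end of the zone beyond which the diagonal is small, the tail bound holds and vectors
     hardly interact with those below N. *)
  assert (Hex : forall N, exists p : R * nat, 0 < fst p <= eps0 /\ (N <= snd p)%nat /\
    tail_bound tau c2 (snd p) /\
    (forall n, (n < N)%nat -> 1 - dg (fst p) n <= eta) /\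
    (forall n, (snd p <= n)%nat -> dg (fst p) n <= eta) /\
    (forall M L x y, (forall n, (N <= n)%nat -> x n = RtoC 0) ->
     (forall m, (m < snd p)%nat -> y m = RtoC 0) ->
     Cmod (form tau M L x y) <= eta * nrm x M * nrm y L)).
  { intros N. destruct (pw_near_one eps0 eta (N + 1) Heps0 Heta) as [eps [He1 He2]].
    destruct (pw_eventually_small eps eta) as [K1 HK1]; [easy|easy|].
    destruct (cross_small tau _ N eta Htc Htaub Heta) as [K2 HK2].
    exists (eps, (N + N0 + K1 + K2)%nat); simpl.
    repeat split; try easy; try lia.
    - apply tail_bound_mono with N0; [lia|easy].
    - intros n Hn. apply He2. lia.
    - intros n Hn. apply HK1. lia.
    - intros M L x y Hx Hy. apply HK2; [easy|]. intros; apply Hy; lia. }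
  apply functional_choice in Hex. destruct Hex as [F HF].
  (* Each zone starts where the previous one ends, so the zones are disjoint. *)
  set (Nb := fun i => Nat.iter i (fun N => snd (F N)) 0%nat).
  set (e := fun i => fst (F (Nb i))).
  assert (HNb : forall i, (Nb i <= Nb (S i))%nat) by (intros i; apply (HF (Nb i))).
  assert (He : forall i, 0 < e i <= eps0) by (intros i; apply (HF (Nb i))).
  set (k0 := c + 2 * C).
  (* The average transition cost is 4 [k0] / sqrt K, which has to be at most [delta] / 2. *)
  destruct (nfloor_ex ((8 * k0 / delta) ^ 2)) as [K0 HK0]; [apply pow2_ge_0|].
  set (K := S K0). assert (HK : 0 < INR K) by (apply lt_0_INR; unfold K; lia).
  assert (Hk0 : 0 <= k0) by (unfold k0; lra).
  assert (HsK : 8 * k0 <= delta * sqrt (INR K)).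
  { assert (8 * k0 / delta <= sqrt (INR K)).
    { rewrite <- (sqrt_pow2 (8 * k0 / delta)).
      - apply sqrt_le_1_alt. unfold K; rewrite S_INR; lra.
      - apply Rmult_le_pos; [lra|left; now apply Rinv_0_lt_compat]. }
    apply Rmult_le_compat_l with (r := delta) in H; [|lra].
    replace (delta * (8 * k0 / delta)) with (8 * k0) in H by (field; lra). easy. }
  exists e, K. split; [unfold K; lia|]. split; [easy|].
  intros M L x y.
  (* [X] and [alpha] do not depend on i, so the target symbol is the mean of the [Z i]. *)
  set (Z := fun i k => Cplus (X k) (Cmult (RtoC b)
      (Cplus (alpha k) (Cmult (RtoC (-1)) (sym_mul alpha (pw (e i)) k))))).
  rewrite (form_ext _ (fun k => Cmult (RtoC (/ INR K)) (csum (fun i => Z i k) K)) M L x x y y);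
    try easy.
  2:{ intros k _. rewrite <- sym_mul_avg_eq. unfold Z.
      rewrite csum_plus, csum_scal, csum_plus, csum_scal.
      assert (Ec : forall z, csum (fun _ => z) K = Cmult (RtoC (INR K)) z).
      { intros z. rewrite <- (Rmult_1_r (INR K)), <- rsum_const, <- csum_RtoC, Cmult_comm, <- csum_scal.
        apply csum_ext; intros; ring. }
      rewrite !Ec, RtoC_inv by lra. field. intros H0. apply RtoC_inj in H0. lra. }
  replace (form (fun k => Cmult (RtoC (/ INR K)) (csum (fun i => Z i k) K)) M L x y)
    with (Cmult (RtoC (/ INR K)) (csum (fun i => form (Z i) M L x y) K)).
  2:{ rewrite <- form_csum. unfold form. rewrite <- csum_scal. apply csum_ext; intros n _.
      rewrite <- csum_scal. apply csum_ext; intros m _. ring. }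
  rewrite Cmod_mult, Cmod_R, Rabs_pos_eq by (left; now apply Rinv_0_lt_compat).
  set (p := nrm x M); set (q := nrm y L).
  assert (Hp : 0 <= p) by apply nrm_nonneg. assert (Hq : 0 <= q) by apply nrm_nonneg.
  assert (Hpq : 0 <= p * q) by now apply Rmult_le_pos.
  apply Rmult_le_reg_l with (INR K); [easy|]. rewrite <- Rmult_assoc, Rinv_r, Rmult_1_l by lra.
  eapply Rle_trans; [apply Cmod_csum|].
  apply Rle_trans with (rsum (fun i => (Rmax c c2 + (2 + 5 * C) * eta) * (p * q)
    + 2 * k0 * (q * nrm (scale (mid (Nb i) (Nb (S i))) x) M
                + p * nrm (scale (mid (Nb i) (Nb (S i))) y) L)) K).
  { apply rsum_le; intros i _. destruct (HF (Nb i)) as (G1 & G2 & G3 & G4 & G5 & G6).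
    rewrite (Rmult_comm q). unfold p, q, k0.
    apply (block_estimate alpha X C c c2 b (e i) eta (Nb i) (Nb (S i))); auto; try lra.
    unfold e; lra. }
  rewrite rsum_plus, rsum_const, rsum_scal, rsum_plus, !rsum_scal.
  pose proof (sum_mid_nrm Nb x M K HNb) as Sx. pose proof (sum_mid_nrm Nb y L K HNb) as Sy.
  fold p in Sx. fold q in Sy.
  apply Rmult_le_compat_l with (r := q) in Sx; [|easy].
  apply Rmult_le_compat_l with (r := p) in Sy; [|easy].
  pose proof (sqrt_pos (INR K)) as Hs0. pose proof (sqrt_sqrt (INR K) (Rlt_le _ _ HK)) as Hss.
  set (sK := sqrt (INR K)) in *.
  apply Rle_trans with (INR K * ((Rmax c c2 + delta / 2) * (p * q)) + 2 * k0 * (2 * (sK * (p * q)))).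
  - apply Rplus_le_compat.
    + apply Rmult_le_compat_l; [lra|]. apply Rmult_le_compat_r; [easy|]. lra.
    + apply Rmult_le_compat_l; lra.
  - assert (8 * k0 * (sK * (p * q)) <= delta * sK * (sK * (p * q)))
      by (apply Rmult_le_compat_r; [now apply Rmult_le_pos|easy]).
    replace (delta * sK * (sK * (p * q))) with (delta * (p * q) * (sK * sK)) in H by ring.
    rewrite Hss in H. lra.
Qed.

(** * Construction of the multiplier *)

(** The pair is (s, g) and encodes X = s T - L with L = M(alpha g). The strict inequality [c < e] is
    the slack consumed by the next step. *)
Definition admissible (alpha : nat -> C) (e : R) (st : R * (nat -> R)) : Prop :=
  0 <= fst st < 1 /\
  (exists c, 0 <= c < e /\ form_bound (sym_mul alpha (fun k => fst st - snd st k)) c) /\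
  vanishing_tail (sym_mul alpha (snd st)).

(** The gap between s and 1 is halved. The pointwise bounds on the increment of g control the limit
    multiplier; the norm bound makes the compact parts converge in norm. *)
Definition improves (alpha : nat -> C) (C eps0 : R) (st st' : R * (nat -> R)) : Prop :=
  fst st' = (1 + fst st) / 2 /\
  (forall k, (fst st' - fst st) * pw eps0 k <= snd st' k - snd st k <= fst st' - fst st) /\
  (forall k, (2 <= k)%nat -> snd st' k - snd st k < fst st' - fst st) /\
  form_bound (sym_mul alpha (fun k => snd st' k - snd st k)) (C * (fst st' - fst st)).

(** With b = s' - s, X + b T equals s' T - M(alpha g), whose tails have norm at most about s' e,
    strictly below e. So both constants fed to the basic inequality are below e. *)
Lemma improve alpha C e eps0 st : 0 <= C -> 0 < eps0 -> form_bound alpha C ->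
  (forall delta, 0 < delta -> exists N, tail_bound alpha (e + delta) N) ->
  admissible alpha e st -> exists st', admissible alpha e st' /\ improves alpha C eps0 st st'.
Proof.
  intros HC Heps0 Halpha He ((Hs0 & Hs1) & (c & (Hc0 & Hce) & HX) & Hg).
  destruct st as [s g]; simpl in *.
  set (X := sym_mul alpha (fun k => s - g k)) in *.
  set (b := (1 - s) / 2). assert (Hb : 0 < b <= 1) by (unfold b; lra).
  set (s' := (1 + s) / 2). assert (Hs' : s' = s + b) by (unfold s', b; lra).
  assert (Hs'1 : s' < 1) by (unfold s'; lra).
  (* [c2] will be at most s' e + 2 [delta], while e (1 - s') = 8 [delta]; e is positive because 0 <=
     c < e. *)
  set (delta := e * (1 - s') / 8).
  assert (Hdelta : 0 < delta) by (unfold delta; apply Rdiv_lt_0_compat; [apply Rmult_lt_0_compat|]; lra).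
  destruct (He delta Hdelta) as [N1 HN1]. destruct (Hg delta Hdelta) as [N2 HN2].
  set (c2 := delta + s' * (e + delta)).
  assert (Hc2 : 0 <= c2) by (unfold c2; nra).
  assert (Hc2e : c2 < e) by (assert (e * (1 - s') = 8 * delta) by (unfold delta; field);
    assert (s' * delta <= 1 * delta) by (apply Rmult_le_compat_r; lra); unfold c2; lra).
  assert (Htau : tail_bound (fun k => Cplus (X k) (Cmult (RtoC b) (alpha k))) c2 (max N1 N2)).
  { eapply tail_bound_ext.
    2:{ eapply tail_bound_le.
        2:{ apply (tail_bound_lin (fun k => Cmult (RtoC (-1)) (sym_mul alpha g k)) alpha s').
            - apply tail_bound_scal. apply tail_bound_mono with N2; [lia|exact HN2].
            - apply tail_bound_mono with N1; [lia|exact HN1]. }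
        unfold c2. rewrite (Rabs_pos_eq s') by lra. rewrite Rabs_left by lra. lra. }
    intros k _. unfold X, sym_mul. rewrite Hs', RtoC_plus, RtoC_minus. ring. }
  assert (Hmax : Rmax c c2 < e) by (apply Rmax_lub_lt; lra).
  assert (Hmax0 : 0 <= Rmax c c2) by (eapply Rle_trans; [exact Hc0|apply Rmax_l]).
  (* Only half of the distance to e is spent, so the new norm is again strictly below e. *)
  destruct (basic_inequality alpha X C c c2 b eps0 ((e - Rmax c c2) / 2) (max N1 N2))
    as (w & K & HK & Hw & HY); try easy; try lra.
  set (G := avg_pw w K) in *.
  assert (HG : forall k, pw eps0 k <= G k <= 1 /\ ((2 <= k)%nat -> G k < 1))
    by (intros; now apply avg_pw_bounds).
  exists (s', fun k => g k + b * G k). split.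
  - split; [simpl; lra|]. split.
    + exists (Rmax c c2 + (e - Rmax c c2) / 2). split; [lra|]. simpl.
      apply form_bound_tail. eapply tail_bound_ext; [|apply form_bound_tail, HY].
      intros k _. unfold X, sym_mul. rewrite Hs', !RtoC_minus, !RtoC_plus, RtoC_mult. ring.
    + simpl. eapply vanishing_tail_ext.
      2:{ apply (vanishing_tail_lin (sym_mul alpha g) (sym_mul alpha G) b Hg).
          apply vanishing_tail_avg with C; auto. intros; apply Hw. }
      intros k _. unfold sym_mul. rewrite RtoC_plus, RtoC_mult. ring.
  - unfold improves; simpl. replace (s' - s) with b by lra.
    split; [easy|]. split; [|split].
    + intros k. destruct (HG k) as [[H1 H2] _]. nra.
    + intros k Hk. destruct (HG k) as [_ H2]. specialize (H2 Hk). nra.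
    + apply form_bound_tail. eapply tail_bound_ext.
      2:{ eapply tail_bound_le; [|apply (tail_bound_scal (sym_mul alpha G) b C)].
          - rewrite Rabs_pos_eq; lra.
          - apply form_bound_tail, form_bound_avg; auto. intros; apply Hw. }
      intros k _. unfold sym_mul.
      replace (g k + b * G k - g k) with (b * G k) by ring. rewrite RtoC_mult. ring.
Qed.

Lemma is_lim_seq_rsum (f : nat -> nat -> R) (l : nat -> R) N :
  (forall i, is_lim_seq (fun n => f n i) (l i)) -> is_lim_seq (fun n => rsum (f n) N) (rsum l N).
Proof.
  intros H. induction N as [|N IH]; simpl; [apply is_lim_seq_const|].
  now apply is_lim_seq_plus'.
Qed.

(** A form on fixed lengths sees finitely many matrix entries, so pointwise convergence of the
    multipliers suffices; [r] bounds the difference. *)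
Lemma tail_bound_limit alpha (h : nat -> nat -> R) (h' : nat -> R) (c : nat -> R) (c' : R) K :
  (forall n, tail_bound (sym_mul alpha (h n)) (c n) K) ->
  (forall k, is_lim_seq (fun n => h n k) (h' k)) -> is_lim_seq c c' ->
  tail_bound (sym_mul alpha h') c' K.
Proof.
  intros H Hh Hc M N a b Hb.
  set (w := fun i j => Cmod (Cmult (Cmult (a i) (b j)) (alpha ((i + 1) * (j + 1))%nat))).
  set (r := fun n => rsum (fun i => rsum (fun j =>
     w i j * Rabs (h' ((i + 1) * (j + 1))%nat - h n ((i + 1) * (j + 1))%nat)) N) M).
  assert (Hr : is_lim_seq r 0).
  { replace 0 with (rsum (fun i => rsum (fun j => w i j * 0) N) M).
    - apply is_lim_seq_rsum; intros i.
      apply (is_lim_seq_rsum (fun n j =>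
        w i j * Rabs (h' ((i + 1) * (j + 1))%nat - h n ((i + 1) * (j + 1))%nat))); intros j.
      apply (is_lim_seq_scal_l _ (w i j) 0).
      apply -> is_lim_seq_abs_0.
      replace (Finite 0) with
        (Finite (h' ((i + 1) * (j + 1))%nat - h' ((i + 1) * (j + 1))%nat)) by (f_equal; ring).
      apply is_lim_seq_minus'; [apply is_lim_seq_const|apply Hh].
    - apply rsum_zero; intros. apply rsum_zero; intros. ring. }
  apply (is_lim_seq_le (fun _ => Cmod (form (sym_mul alpha h') M N a b))
    (fun n => c n * nrm a M * nrm b N + r n) (Cmod (form (sym_mul alpha h') M N a b))
    (c' * nrm a M * nrm b N)); [|apply is_lim_seq_const|].
  - intros n.
    replace (form (sym_mul alpha h') M N a b) with (Cplus (form (sym_mul alpha (h n)) M N a b)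
      (form (sym_mul alpha (fun k => h' k - h n k)) M N a b)).
    + apply Cmod_plus_le; [now apply H|].
      unfold form, r. eapply Rle_trans; [apply Cmod_csum|]. apply rsum_le; intros i _.
      eapply Rle_trans; [apply Cmod_csum|]. apply rsum_le; intros j _.
      unfold w, sym_mul. rewrite Cmult_assoc, Cmod_mult, Cmod_R. lra.
    + rewrite <- (Cmult_1_l (form (sym_mul alpha (fun k => h' k - h n k)) M N a b)), <- form_lin.
      apply form_ext; try easy. intros k _. unfold sym_mul. rewrite RtoC_minus. ring.
  - rewrite <- (Rplus_0_r (c' * nrm a M * nrm b N)). apply is_lim_seq_plus'; [|easy].
    apply (is_lim_seq_scal_r _ (nrm b N) (c' * nrm a M)).
    now apply (is_lim_seq_scal_r _ (nrm a M) c').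
Qed.

(** The lower bound by [pw eps0] serves non-uniqueness: a small [eps0] pushes g towards 1 at a
    prescribed argument. *)
Lemma multiplier_exists alpha C e eps0 : 0 <= C -> 0 < e -> 0 < eps0 -> form_bound alpha C ->
  (forall delta, 0 < delta -> exists N, tail_bound alpha (e + delta) N) ->
  exists g : nat -> R,
    form_bound (sym_mul alpha (fun k => 1 - g k)) e /\
    form_bound (sym_mul alpha g) C /\
    vanishing_tail (sym_mul alpha g) /\
    (forall k, pw eps0 k <= g k) /\
    (forall k, (2 <= k)%nat -> g k < 1).
Proof.
  intros HC He0 Heps0 Halpha He.
  (* [functional_choice] asks for a successor of every pair; for an inadmissible one nothing is
     demanded of it. *)
  assert (Hch : forall st, exists st', admissible alpha e st ->
    admissible alpha e st' /\ improves alpha C eps0 st st').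
  { intros st. destruct (classic (admissible alpha e st)) as [H|H].
    - destruct (improve alpha C e eps0 st) as [st' Hst']; auto. now exists st'.
    - now exists st. }
  apply functional_choice in Hch. destruct Hch as [F HF].
  set (st := fun n => Nat.iter n F (0, fun _ => 0)).
  assert (Hadm : forall n, admissible alpha e (st n)).
  { induction n as [|n IH]; [|now apply (HF (st n))].
    (* The start is X = 0, whose norm 0 is below e because e is positive. *)
    unfold st, admissible; simpl. split; [lra|]. split.
    - exists 0. split; [lra|]. intros M N a b. unfold form. rewrite csum_zero, Cmod_0; [lra|].
      intros n _. apply csum_zero; intros m _. unfold sym_mul. rewrite Rminus_0_r. ring.
    - apply vanishing_tail_zero. intros; unfold sym_mul; ring. }
  assert (Himp : forall n, improves alpha C eps0 (st n) (st (S n)))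
    by (intros n; now apply (HF (st n))).
  set (s := fun n => fst (st n)). set (g := fun n => snd (st n)).
  assert (Es : forall n, s n = 1 - (1 / 2) ^ n).
  { induction n as [|n IH]; [unfold s; simpl; ring|].
    destruct (Himp n) as [E _]. change (s (S n) = (1 + s n) / 2) in E. rewrite E, IH. simpl. field. }
  assert (Hslim : is_lim_seq s 1).
  { apply is_lim_seq_ext with (fun n => 1 - (1 / 2) ^ n); [intros; now rewrite Es|].
    replace (Finite 1) with (Finite (1 - 0)) by (f_equal; ring).
    apply is_lim_seq_minus'; [apply is_lim_seq_const|].
    apply is_lim_seq_geom. rewrite Rabs_pos_eq; lra. }
  assert (Hs1 : forall n, s n <= 1) by (intros n; rewrite Es; pose proof (pow_le (1 / 2) n); lra).
  (* Over m steps the increments telescope, with bounds that stay controlled as m tends to infinity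
     for fixed n. *)
  assert (Hinc : forall n m,
    (forall k, (s (n + m)%nat - s n) * pw eps0 k <= g (n + m)%nat k - g n k <= s (n + m)%nat - s n) /\
    form_bound (sym_mul alpha (fun k => g (n + m)%nat k - g n k)) (C * (s (n + m)%nat - s n))).
  { intros n m. induction m as [|m [IH1 IH2]].
    - rewrite Nat.add_0_r. split; [intros; lra|].
      intros M N a b. unfold form. rewrite csum_zero, Cmod_0; [lra|].
      intros i _. apply csum_zero; intros j _. unfold sym_mul. rewrite Rminus_diag. ring.
    - rewrite Nat.add_succ_r. destruct (Himp (n + m)%nat) as (_ & H1 & _ & H2).
      fold (s (n + m)%nat) (s (S (n + m))) (g (n + m)%nat) (g (S (n + m))) in H1, H2. split.
      + intros k. specialize (IH1 k). specialize (H1 k). lra.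
      + apply form_bound_tail. eapply tail_bound_ext.
        2:{ eapply tail_bound_le.
            2:{ apply (tail_bound_lin _ _ 1 _ _ 0%nat (proj1 (form_bound_tail _ _) IH2)
                  (proj1 (form_bound_tail _ _) H2)). }
            rewrite Rabs_R1. lra. }
        intros k _. unfold sym_mul. rewrite !RtoC_minus. ring. }
  assert (Hs0 : s 0%nat = 0) by reflexivity. assert (Hg0 : forall k, g 0%nat k = 0) by reflexivity.
  assert (Hglim : forall k, exists l : R, is_lim_seq (fun n => g n k) l).
  { intros k. destruct (ex_finite_lim_seq_incr (fun n => g n k) 1) as [l Hl]; [| |now exists l].
    - intros n. destruct (Hinc n 1%nat) as [H _]. specialize (H k). rewrite Nat.add_1_r in H.
      pose proof (pw_pos eps0 k). assert (s n <= s (S n)).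
      { rewrite !Es. simpl. pose proof (pow_le (1 / 2) n). lra. }
      nra.
    - intros n. destruct (Hinc 0%nat n) as [H _]. specialize (H k). simpl in H.
      rewrite Hg0, Hs0 in H. specialize (Hs1 n). lra. }
  apply functional_choice in Hglim. destruct Hglim as [gl Hgl].
  exists gl.
  assert (Hgl' : forall n k, is_lim_seq (fun m => g (n + m)%nat k) (gl k)).
  { intros n k. apply is_lim_seq_ext with (fun m => g (m + n)%nat k);
      [intros; now rewrite Nat.add_comm|].
    now apply (is_lim_seq_incr_n (fun m => g m k) n). }
  assert (Hslim' : forall n, is_lim_seq (fun m => s (n + m)%nat) 1).
  { intros n. apply is_lim_seq_ext with (fun m => s (m + n)%nat);
      [intros; now rewrite Nat.add_comm|]. now apply (is_lim_seq_incr_n s n). }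
  (* M(alpha g_n) converges in norm at rate C 2^(-n), so vanishing tails pass to the limit. *)
  assert (Htailn : forall n, form_bound (sym_mul alpha (fun k => gl k - g n k)) (C * (1 - s n))).
  { intros n. apply form_bound_tail.
    apply (tail_bound_limit alpha (fun m k => g (n + m)%nat k - g n k) _
      (fun m => C * (s (n + m)%nat - s n))).
    - intros m. apply form_bound_tail, Hinc.
    - intros k. apply is_lim_seq_minus'; [apply Hgl'|apply is_lim_seq_const].
    - apply (is_lim_seq_scal_l _ C (1 - s n)).
      apply is_lim_seq_minus'; [apply Hslim'|apply is_lim_seq_const]. }
  split; [|split; [|split; [|split]]].
  - apply form_bound_tail.
    apply (tail_bound_limit alpha (fun m k => s m - g m k) _ (fun m => e)).
    + intros m. destruct (Hadm m) as (_ & (c & Hc & H) & _).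
      apply tail_bound_le with c; [lra|]. now apply form_bound_tail.
    + intros k. now apply is_lim_seq_minus'.
    + apply is_lim_seq_const.
  - specialize (Htailn 0%nat). rewrite Hs0, Rminus_0_r, Rmult_1_r in Htailn.
    apply form_bound_tail. eapply tail_bound_ext; [|apply form_bound_tail, Htailn].
    intros k _. unfold sym_mul. now rewrite Hg0, Rminus_0_r.
  - intros eps Heps.
    destruct (pow_lt_1_zero (1 / 2)) with (y := eps / (2 * (1 + C))) as [n Hn].
    { rewrite Rabs_pos_eq; lra. }
    { apply Rdiv_lt_0_compat; lra. }
    specialize (Hn n (le_n n)). rewrite Rabs_pos_eq in Hn by (apply pow_le; lra).
    destruct (Hadm n) as (_ & _ & Hv). destruct (Hv (eps / 2)) as [K HK]; [lra|].
    exists K. eapply tail_bound_ext.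
    2:{ eapply tail_bound_le.
        2:{ apply (tail_bound_lin _ (sym_mul alpha (fun k => gl k - g n k)) 1 _ (C * (1 - s n)) K HK).
            apply (tail_bound_mono _ _ 0); [lia|]. apply form_bound_tail, (Htailn n). }
        rewrite Rabs_R1, Es.
        assert (C * (1 / 2) ^ n <= (1 + C) * (eps / (2 * (1 + C)))).
        { apply Rmult_le_compat; try lra. apply pow_le; lra. }
        replace ((1 + C) * (eps / (2 * (1 + C)))) with (eps / 2) in H by (field; lra). lra. }
    intros k _. unfold sym_mul. fold (g n). rewrite RtoC_minus. ring.
  - intros k. rewrite <- (Rmult_1_l (pw eps0 k)).
    apply (is_lim_seq_le (fun n => s n * pw eps0 k) (fun n => g n k) (1 * pw eps0 k) (gl k)).
    + intros n. destruct (Hinc 0%nat n) as [H _]. specialize (H k). simpl in H.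
      rewrite Hg0, Hs0 in H. lra.
    + now apply (is_lim_seq_scal_r _ (pw eps0 k) 1).
    + apply Hgl.
  (* A strict inequality could be lost in the limit. It is won in the first step and kept, since
     later increments of g never exceed those of s. *)
  - intros k Hk. destruct (Himp 0%nat) as (_ & _ & H & _). specialize (H k Hk).
    fold (s 0%nat) (s 1%nat) (g 0%nat) (g 1%nat) in H. rewrite Hg0, Hs0 in H.
    apply Rle_lt_trans with (g 1%nat k + (1 - s 1%nat)); [|lra].
    apply (is_lim_seq_le (fun m => g (1 + m)%nat k) (fun m => g 1%nat k + (s (1 + m)%nat - s 1%nat))
      (gl k) (g 1%nat k + (1 - s 1%nat))).
    + intros m. destruct (Hinc 1%nat m) as [H1 _]. specialize (H1 k). lra.
    + apply Hgl'.
    + apply is_lim_seq_plus'; [apply is_lim_seq_const|].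
      apply is_lim_seq_minus'; [apply Hslim'|apply is_lim_seq_const].
Qed.

(** * Square summable sequences *)

Lemma is_lim_seq_rsum_series f : ex_series f -> is_lim_seq (rsum f) (Series f).
Proof.
  intros H. apply is_lim_seq_incr_1.
  apply is_lim_seq_ext with (sum_n f); [intros; now rewrite rsum_sum_n|].
  exact (Series_correct f H).
Qed.

Lemma series_nonneg_bounded f c : (forall n, 0 <= f n) -> (forall N, rsum f N <= c) ->
  ex_series f /\ Series f <= c.
Proof.
  intros Hf Hc.
  assert (Hex : ex_series f).
  { destruct (ex_finite_lim_seq_incr (sum_n f) c) as [l Hl].
    - intros n. rewrite <- !rsum_sum_n. simpl. specialize (Hf (S n)). lra.
    - intros n. rewrite <- rsum_sum_n. apply Hc.
    - now exists l. }
  split; [easy|].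
  apply (is_lim_seq_le (rsum f) (fun _ => c) (Series f) c); auto.
  - now apply is_lim_seq_rsum_series.
  - apply is_lim_seq_const.
Qed.

Lemma rsum_le_series f N : (forall n, 0 <= f n) -> ex_series f -> rsum f N <= Series f.
Proof.
  intros Hf H.
  apply (is_lim_seq_incr_compare (rsum f) (Series f)); [now apply is_lim_seq_rsum_series|].
  intros n. simpl. specialize (Hf n). lra.
Qed.

Lemma nrm_le_l2norm x N : in_l2 x -> nrm x N <= l2norm x.
Proof.
  intros H. apply sqrt_le_1_alt, rsum_le_series; [intros; apply pow2_ge_0|easy].
Qed.

Lemma l2norm_le x c : (forall N, nrm x N <= c) -> in_l2 x /\ l2norm x <= c.
Proof.
  intros H. assert (Hc : 0 <= c) by (eapply Rle_trans; [apply (nrm_nonneg x 0)|apply H]).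
  destruct (series_nonneg_bounded (fun n => Cmod (x n) ^ 2) (c ^ 2)) as [H1 H2].
  - intros; apply pow2_ge_0.
  - intros N. fold (nrm2 x N). rewrite <- nrm_sqr. apply pow_incr.
    split; [apply nrm_nonneg|apply H].
  - split; [exact H1|]. unfold l2norm. rewrite <- (sqrt_pow2 c Hc). now apply sqrt_le_1_alt.
Qed.

Lemma l2norm_nonneg x : 0 <= l2norm x.
Proof. apply sqrt_pos. Qed.

Lemma l2_finite a M : in_l2 (scale (lo M) a) /\ l2norm (scale (lo M) a) <= nrm a M.
Proof.
  apply l2norm_le. intros N. apply Rle_trans with (nrm (scale (lo M) a) (max M N)).
  - apply nrm_mono; lia.
  - apply sqrt_le_1_alt. unfold nrm2. rewrite (rsum_extend _ M); [|lia|].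
    + apply rsum_le. intros n Hn. unfold scale. rewrite Cmod_mult, Cmod_R.
      destruct (lo_cases M n) as [[_ ->]|[? _]]; [|lia]. rewrite Rabs_R1, Rmult_1_l; lra.
    + intros n Hn. unfold scale. destruct (lo_cases M n) as [[? _]|[_ ->]]; [lia|].
      rewrite Cmult_0_l, Cmod_0. ring.
Qed.

Lemma nrm_cscal c x N : nrm (fun n => Cmult c (x n)) N = Cmod c * nrm x N.
Proof.
  unfold nrm. rewrite <- (sqrt_pow2 (Cmod c)) by apply Cmod_ge_0.
  rewrite <- sqrt_mult; [|apply pow2_ge_0|apply nrm2_nonneg]. f_equal.
  unfold nrm2. rewrite <- rsum_scal. apply rsum_ext; intros n _.
  rewrite Cmod_mult, Rpow_mult_distr. easy.
Qed.

Lemma l2_lin x y c : in_l2 x -> in_l2 y ->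
  in_l2 (fun n => Cplus (x n) (Cmult c (y n))) /\
  l2norm (fun n => Cplus (x n) (Cmult c (y n))) <= l2norm x + Cmod c * l2norm y.
Proof.
  intros Hx Hy. apply l2norm_le. intros N.
  eapply Rle_trans; [apply (nrm_triangle x (fun n => Cmult c (y n)))|].
  rewrite nrm_cscal. apply Rplus_le_compat; [now apply nrm_le_l2norm|].
  apply Rmult_le_compat_l; [apply Cmod_ge_0|now apply nrm_le_l2norm].
Qed.

Lemma in_l2_zero : in_l2 (fun _ => RtoC 0) /\ l2norm (fun _ => RtoC 0) <= 0.
Proof.
  apply l2norm_le. intros N. apply nrm_le_of_sqr; [lra|]. unfold nrm2.
  rewrite rsum_zero; [lra|]. intros; rewrite Cmod_0; ring.
Qed.

(** * Coordinatewise limits *)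

(** Convergence by real and imaginary parts matches the form of [Cseries]. *)
Definition cconv (u : nat -> C) (l : C) : Prop :=
  is_lim_seq (fun n => fst (u n)) (fst l) /\ is_lim_seq (fun n => snd (u n)) (snd l).

Lemma cconv_unique u l l' : cconv u l -> cconv u l' -> l = l'.
Proof.
  intros [H1 H2] [H1' H2']. apply injective_projections.
  - apply is_lim_seq_unique in H1. apply is_lim_seq_unique in H1'. congruence.
  - apply is_lim_seq_unique in H2. apply is_lim_seq_unique in H2'. congruence.
Qed.

Lemma cconv_lin u v l l' c : cconv u l -> cconv v l' ->
  cconv (fun n => Cplus (u n) (Cmult c (v n))) (Cplus l (Cmult c l')).
Proof.
  intros [H1 H2] [H1' H2']. destruct c as [x y]. split; simpl.
  - apply is_lim_seq_plus'; [easy|]. apply is_lim_seq_minus'.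
    + now apply (is_lim_seq_scal_l _ x (fst l')).
    + now apply (is_lim_seq_scal_l _ y (snd l')).
  - apply is_lim_seq_plus'; [easy|]. apply is_lim_seq_plus'.
    + now apply (is_lim_seq_scal_l _ x (snd l')).
    + now apply (is_lim_seq_scal_l _ y (fst l')).
Qed.

Lemma cconv_const l : cconv (fun _ => l) l.
Proof. split; apply is_lim_seq_const. Qed.

Lemma cconv_ext_loc u v l : (exists N, forall n, (N <= n)%nat -> u n = v n) -> cconv u l -> cconv v l.
Proof.
  intros [N HN] [H1 H2].
  split; [apply is_lim_seq_ext_loc with (2 := H1)|apply is_lim_seq_ext_loc with (2 := H2)];
    exists N; intros n Hn; now rewrite HN.
Qed.

Lemma cconv_scal c u l : cconv u l -> cconv (fun n => Cmult c (u n)) (Cmult c l).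
Proof.
  intros H. rewrite <- (Cplus_0_l (Cmult c l)).
  apply cconv_ext_loc with (fun n => Cplus (RtoC 0) (Cmult c (u n))).
  - exists 0%nat. intros; apply Cplus_0_l.
  - apply cconv_lin; [apply cconv_const|easy].
Qed.

Lemma nrm2_conv (v : nat -> nat -> C) w N : (forall m, cconv (fun k => v k m) (w m)) ->
  is_lim_seq (fun k => nrm2 (v k) N) (nrm2 w N).
Proof.
  intros H. apply (is_lim_seq_rsum (fun k m => Cmod (v k m) ^ 2)). intros m.
  rewrite Cmod2_alt.
  apply is_lim_seq_ext with (fun k => fst (v k m) * fst (v k m) + snd (v k m) * snd (v k m)).
  { intros k. rewrite Cmod2_alt. unfold Re, Im. ring. }
  replace (Re (w m) ^ 2 + Im (w m) ^ 2) with (fst (w m) * fst (w m) + snd (w m) * snd (w m))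
    by (unfold Re, Im; ring).
  destruct (H m). apply is_lim_seq_plus'; now apply is_lim_seq_mult'.
Qed.

(** Fatou's lemma in the form needed here: bounds on truncations survive coordinatewise limits, and
    being uniform in N they give bounds in l^2. *)
Lemma nrm_conv_le (v : nat -> nat -> C) w N c : (forall m, cconv (fun k => v k m) (w m)) ->
  (forall k, nrm (v k) N <= c) -> nrm w N <= c.
Proof.
  intros H Hc. assert (Hc0 : 0 <= c) by (eapply Rle_trans; [apply (nrm_nonneg (v 0%nat) N)|apply Hc]).
  apply nrm_le_of_sqr; [easy|].
  apply (is_lim_seq_le (fun k => nrm2 (v k) N) (fun _ => c ^ 2) (nrm2 w N) (c ^ 2)).
  - intros k. rewrite <- nrm_sqr. apply pow_incr. split; [apply nrm_nonneg|apply Hc].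
  - now apply nrm2_conv.
  - apply is_lim_seq_const.
Qed.

(** * The operator of a bounded symbol *)

Lemma Cmod_fst_le z : Rabs (fst z) <= Cmod z.
Proof. pose proof (Rmax_Cmod z). eapply Rle_trans; [apply Rmax_l|eassumption]. Qed.

Lemma Cmod_snd_le z : Rabs (snd z) <= Cmod z.
Proof. pose proof (Rmax_Cmod z). eapply Rle_trans; [apply Rmax_r|eassumption]. Qed.

Lemma ex_series_dominated f g c : (forall n, Rabs (f n) <= g n) -> (forall N, rsum g N <= c) ->
  ex_series f.
Proof.
  intros Hfg Hc. apply ex_series_Rabs.
  apply (series_nonneg_bounded (fun n => Rabs (f n)) c); [intros; apply Rabs_pos|].
  intros N. eapply Rle_trans; [|apply (Hc N)]. now apply rsum_le.
Qed.

(** Rows are square summable, so the series in [Mop] converges absolutely by Cauchy-Schwarz; only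
    then is the value of [Series] meaningful. *)
Lemma Mop_conv gamma C x m : 0 <= C -> form_bound gamma C -> in_l2 x ->
  cconv (fun M => image gamma M x m) (Mop gamma x m).
Proof.
  intros HC H Hx.
  assert (Hb : forall N, rsum (fun n => Cmod (Cmult (gamma ((n + 1) * (m + 1))%nat) (x n))) N
                         <= C * l2norm x).
  { intros N.
    rewrite (rsum_ext _ (fun n => Cmod (gamma ((m + 1) * (n + 1))%nat) * Cmod (x n)))
      by (intros; rewrite Cmod_mult, (Nat.mul_comm (m + 1)); easy).
    eapply Rle_trans; [apply Rle_abs|].
    eapply Rle_trans; [apply (rsum_CS (fun n => Cmod (gamma ((m + 1) * (n + 1))%nat)))|].
    apply Rmult_le_compat; try apply sqrt_pos.
    - apply (row_bound gamma C m N HC H).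
    - now apply nrm_le_l2norm. }
  split; unfold image, Mop, Cseries; simpl.
  - apply is_lim_seq_ext with (rsum (fun n => fst (Cmult (gamma ((n + 1) * (m + 1))%nat) (x n)))).
    { intros n. now rewrite csum_fst. }
    apply is_lim_seq_rsum_series. eapply ex_series_dominated; [|exact Hb].
    intros n. exact (Cmod_fst_le (Cmult (gamma ((n + 1) * (m + 1))%nat) (x n))).
  - apply is_lim_seq_ext with (rsum (fun n => snd (Cmult (gamma ((n + 1) * (m + 1))%nat) (x n)))).
    { intros n. now rewrite csum_snd. }
    apply is_lim_seq_rsum_series. eapply ex_series_dominated; [|exact Hb].
    intros n. exact (Cmod_snd_le (Cmult (gamma ((n + 1) * (m + 1))%nat) (x n))).
Qed.

Lemma Mop_tail gamma C c K N x : 0 <= C -> 0 <= c -> form_bound gamma C -> tail_bound gamma c K ->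
  in_l2 x -> nrm (scale (hi K) (Mop gamma x)) N <= c * l2norm x.
Proof.
  intros HC Hc H HK Hx.
  apply (nrm_conv_le (fun M => scale (hi K) (image gamma M x))).
  - intros m. apply cconv_scal. now apply Mop_conv with C.
  - intros M. eapply Rle_trans; [now apply tail_image with (c := c)|].
    apply Rmult_le_compat_l; [easy|now apply nrm_le_l2norm].
Qed.

Lemma Mop_bound gamma C x : 0 <= C -> form_bound gamma C ->
  in_l2 x -> in_l2 (Mop gamma x) /\ l2norm (Mop gamma x) <= C * l2norm x.
Proof.
  intros HC H Hx. apply l2norm_le. intros N.
  apply (nrm_conv_le (fun M => image gamma M x)).
  - intros m. now apply Mop_conv with C.
  - intros M. eapply Rle_trans; [now apply image_bound with (c := C)|].
    apply Rmult_le_compat_l; [easy|now apply nrm_le_l2norm].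
Qed.

Lemma Mop_bounded gamma C : 0 <= C -> form_bound gamma C -> is_bounded_op (Mop gamma).
Proof.
  intros HC H. split; [|split].
  - intros x y c Hx Hy. extensionality m.
    destruct (l2_lin x y c Hx Hy) as [Hxy _].
    apply (cconv_unique (fun M => image gamma M (fun n => Cplus (x n) (Cmult c (y n))) m)).
    + now apply Mop_conv with C.
    + apply cconv_ext_loc with (fun M => Cplus (image gamma M x m) (Cmult c (image gamma M y m))).
      * exists 0%nat. intros M _. unfold image. rewrite <- csum_scal, <- csum_plus.
        apply csum_ext; intros; ring.
      * apply cconv_lin; now apply Mop_conv with C.
  - intros x Hx. now apply Mop_bound with C.
  - exists C. intros x Hx. now apply Mop_bound.
Qed.

Lemma Mop_sub gamma gamma' C C' x : 0 <= C -> 0 <= C' ->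
  form_bound gamma C -> form_bound gamma' C' -> in_l2 x ->
  op_sub (Mop gamma) (Mop gamma') x = Mop (fun k => Cminus (gamma k) (gamma' k)) x.
Proof.
  intros HC HC' H H' Hx. extensionality m.
  assert (Hd : form_bound (fun k => Cminus (gamma k) (gamma' k)) (C + Rabs (-1) * C')).
  { apply form_bound_tail. eapply tail_bound_ext.
    2:{ apply tail_bound_lin; apply form_bound_tail; eassumption. }
    intros k _. cbv beta. ring. }
  apply (cconv_unique (fun M => image (fun k => Cminus (gamma k) (gamma' k)) M x m)).
  - apply cconv_ext_loc with
      (fun M => Cplus (image gamma M x m) (Cmult (RtoC (-1)) (image gamma' M x m))).
    + exists 0%nat. intros M _. unfold image. rewrite <- csum_scal, <- csum_plus.
      apply csum_ext; intros. ring.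
    + unfold op_sub. replace (Cminus (Mop gamma x m) (Mop gamma' x m)) with
        (Cplus (Mop gamma x m) (Cmult (RtoC (-1)) (Mop gamma' x m))) by (ring).
      apply cconv_lin; [now apply Mop_conv with C|now apply Mop_conv with C'].
  - eapply Mop_conv; [|exact Hd|easy]. pose proof (Rabs_pos (-1)). nra.
Qed.

Lemma Mop_finite gamma C M a : 0 <= C -> form_bound gamma C ->
  Mop gamma (scale (lo M) a) = image gamma M a.
Proof.
  intros HC H. extensionality m.
  apply (cconv_unique (fun L => image gamma L (scale (lo M) a) m)).
  - apply Mop_conv with C; auto. apply l2_finite.
  - apply cconv_ext_loc with (fun _ => image gamma M a m); [|apply cconv_const].
    exists M. intros L HL. unfold image. symmetry. rewrite (csum_extend _ M L HL).
    + apply csum_ext. intros n Hn. unfold scale.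
      destruct (lo_cases M n) as [[_ ->]|[? _]]; [ring|lia].
    + intros n Hn. unfold scale. destruct (lo_cases M n) as [[? _]|[_ ->]]; [lia|ring].
Qed.

(** * Operator norms *)

(** [opnorm] applies [real] to a supremum and is meaningful only if that is finite; the zero vector
    shows that the set is not empty. *)
Lemma opnorm_bounds T c : 0 <= c -> (forall x, in_l2 x -> l2norm (T x) <= c * l2norm x) ->
  0 <= opnorm T <= c /\ forall x, in_l2 x -> l2norm x <= 1 -> l2norm (T x) <= opnorm T.
Proof.
  intros Hc H. unfold opnorm.
  set (E := fun r => exists x, in_l2 x /\ l2norm x <= 1 /\ r = l2norm (T x)).
  destruct (Lub_Rbar_correct E) as [Hub Hlub].
  assert (HE : forall r, E r -> 0 <= r <= c).
  { intros r (x & Hx & Hx1 & ->). split; [apply l2norm_nonneg|].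
    eapply Rle_trans; [now apply H|]. pose proof (l2norm_nonneg x). nra. }
  assert (H0 : E (l2norm (T (fun _ => RtoC 0)))).
  { exists (fun _ => RtoC 0). destruct in_l2_zero. repeat split; [easy|lra]. }
  assert (Hle : Rbar_le (Lub_Rbar E) c) by (apply Hlub; intros r Hr; apply HE, Hr).
  assert (Hge := Hub _ H0). pose proof (HE _ H0).
  destruct (Lub_Rbar E) as [l| |]; simpl in *; [|easy|easy].
  split; [lra|]. intros x Hx Hx1. apply (Hub (l2norm (T x))). exists x; auto.
Qed.

Lemma bounded_op_const T : is_bounded_op T ->
  exists c, 0 <= c /\ forall x, in_l2 x -> l2norm (T x) <= c * l2norm x.
Proof.
  intros (_ & _ & c & Hc). exists (Rabs c). split; [apply Rabs_pos|].
  intros x Hx. eapply Rle_trans; [now apply Hc|].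
  apply Rmult_le_compat_r; [apply l2norm_nonneg|apply Rle_abs].
Qed.

Lemma linear_zero T : is_linear_l2 T -> T (fun _ => RtoC 0) = fun _ => RtoC 0.
Proof.
  intros H. destruct in_l2_zero as [H0 _].
  specialize (H _ _ (RtoC (-1)) H0 H0).
  transitivity (T (fun n => Cplus (RtoC 0) (Cmult (RtoC (-1)) (RtoC 0)))).
  - f_equal. extensionality n. ring.
  - etransitivity; [exact H|]. extensionality n. ring.
Qed.

Lemma homogeneous_bound T d L c : is_bounded_op T -> (forall n, Rabs (d n) <= 1) ->
  (forall x, in_l2 x -> l2norm x <= 1 -> nrm (scale d (T x)) L <= c) ->
  forall x, in_l2 x -> nrm (scale d (T x)) L <= c * l2norm x.
Proof.
  intros HT Hd H x Hx. destruct (bounded_op_const T HT) as (c' & Hc' & Hb).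
  destruct HT as (Hlin & Hin & _). pose proof (l2norm_nonneg x) as Hn.
  destruct (Req_dec (l2norm x) 0) as [E|E].
  - rewrite E, Rmult_0_r. eapply Rle_trans; [now apply nrm_scale_le1|].
    eapply Rle_trans; [apply nrm_le_l2norm; auto|]. specialize (Hb x Hx). rewrite E in Hb. lra.
  - set (r := l2norm x) in *. assert (Hr : 0 < r) by lra.
    (* [is_linear_l2] speaks of x + c y only, so the normalised vector is written as 0 + x / r. *)
    destruct in_l2_zero as [H0 H0n].
    destruct (l2_lin _ _ (RtoC (/ r)) H0 Hx) as [Hy Hyn].
    pose proof (Hlin _ _ (RtoC (/ r)) H0 Hx) as HL. rewrite linear_zero in HL by easy.
    rewrite Cmod_R, Rabs_pos_eq in Hyn by (left; now apply Rinv_0_lt_compat).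
    assert (Hy1 : l2norm (fun n => Cplus (RtoC 0) (Cmult (RtoC (/ r)) (x n))) <= 1).
    { eapply Rle_trans; [exact Hyn|]. fold r. rewrite Rinv_l by lra. lra. }
    specialize (H _ Hy Hy1). rewrite HL in H.
    rewrite (nrm_ext _ (fun n => Cmult (RtoC (/ r)) (scale d (T x) n))) in H
      by (intros; unfold scale; ring).
    rewrite nrm_cscal, Cmod_R, Rabs_pos_eq in H by (left; now apply Rinv_0_lt_compat).
    apply Rmult_le_compat_l with (r := r) in H; [|lra].
    rewrite <- Rmult_assoc, Rinv_r, Rmult_1_l in H by lra. lra.
Qed.

Lemma opnorm_nrm T d L x : is_bounded_op T -> (forall n, Rabs (d n) <= 1) -> in_l2 x ->
  nrm (scale d (T x)) L <= opnorm T * l2norm x.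
Proof.
  intros HT Hd. revert x. apply homogeneous_bound; [easy|easy|]. intros x Hx Hx1.
  eapply Rle_trans; [now apply nrm_scale_le1|].
  eapply Rle_trans; [apply nrm_le_l2norm; apply (proj1 (proj2 HT)); easy|].
  destruct (bounded_op_const T HT) as (c & Hc & Hb). now apply (opnorm_bounds T c).
Qed.

Lemma op_sub_bounded S T : is_bounded_op S -> is_bounded_op T -> is_bounded_op (op_sub S T).
Proof.
  intros HS HT.
  destruct (bounded_op_const S HS) as (c & Hc & Hb). destruct (bounded_op_const T HT) as (c' & Hc' & Hb').
  destruct HS as (L1 & I1 & _), HT as (L2 & I2 & _).
  assert (E : forall x, op_sub S T x = fun n => Cplus (S x n) (Cmult (RtoC (-1)) (T x n))).
  { intros x. extensionality n. unfold op_sub. ring. }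
  split; [|split].
  - intros x y t Hx Hy. unfold op_sub. rewrite L1, L2 by easy. extensionality n. ring.
  - intros x Hx. rewrite E. apply l2_lin; auto.
  - exists (c + c'). intros x Hx. rewrite E.
    eapply Rle_trans; [apply l2_lin; auto|].
    rewrite Cmod_R, Rabs_left by lra. specialize (Hb x Hx). specialize (Hb' x Hx). lra.
Qed.

(** * Sesquilinear and bilinear boundedness *)

Lemma nrm_conj b N : nrm (fun m => Cconj (b m)) N = nrm b N.
Proof.
  unfold nrm, nrm2. f_equal. apply rsum_ext; intros. now rewrite Cmod_conj.
Qed.

Lemma Cconj_zero : Cconj (RtoC 0) = RtoC 0.
Proof. unfold Cconj, RtoC; simpl. now rewrite Ropp_0. Qed.

(** Conjugating the second vector turns one form into the other; the cut-offs supply finite support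
    and the common length [max M N]. *)
Lemma mh_bounded_form gamma : mh_bounded gamma -> exists C, 0 <= C /\ form_bound gamma C.
Proof.
  intros (c & Hc & H). exists c. split; [lra|]. intros M N a b.
  set (a0 := scale (lo M) a). set (b0 := scale (lo N) b).
  assert (Ha : forall n, (M <= n)%nat -> a0 n = RtoC 0).
  { intros n Hn. unfold a0, scale. destruct (lo_cases M n) as [[? _]|[_ ->]]; [lia|ring]. }
  assert (Hb : forall n, (N <= n)%nat -> b0 n = RtoC 0).
  { intros n Hn. unfold b0, scale. destruct (lo_cases N n) as [[? _]|[_ ->]]; [lia|ring]. }
  specialize (H a0 (fun m => Cconj (b0 m)) (max M N)).
  assert (E : form gamma M N a b = csum (fun n => csum (fun m => Cmult (Cmult (a0 n)
     (Cconj (Cconj (b0 m)))) (gamma ((n + 1) * (m + 1))%nat)) (max M N)) (max M N)).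
  { rewrite (csum_extend _ M (max M N)); [|lia|].
    - apply csum_ext; intros n Hn. rewrite (csum_extend _ N (max M N)); [|lia|].
      + apply csum_ext; intros m Hm. rewrite Cconj_conj. unfold a0, b0, scale.
        destruct (lo_cases M n) as [[_ ->]|[? _]]; [|lia].
        destruct (lo_cases N m) as [[_ ->]|[? _]]; [|lia]. ring.
      + intros m Hm. rewrite Cconj_conj, Hb by easy. ring.
    - intros n Hn. apply csum_zero. intros m _. rewrite Ha by easy. ring. }
  rewrite E. eapply Rle_trans; [apply H|].
  - intros n Hn. apply Ha; lia.
  - intros n Hn. rewrite Hb by lia. apply Cconj_zero.
  - assert (Hl : l2norm a0 <= nrm a M) by apply l2_finite.
    assert (Hl' : l2norm (fun m => Cconj (b0 m)) <= nrm b N).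
    { apply l2norm_le. intros L. rewrite nrm_conj.
      destruct (l2_finite b N) as [H1 H2]. eapply Rle_trans; [|exact H2]. now apply nrm_le_l2norm. }
    apply Rmult_le_compat; try apply l2norm_nonneg; [|apply Rmult_le_compat_l; lra|easy].
    apply Rmult_le_pos; [lra|apply l2norm_nonneg].
Qed.

Lemma fin_supp_l2 a N : fin_supp a N -> in_l2 a.
Proof.
  intros H. replace a with (scale (lo N) a); [apply l2_finite|].
  extensionality n. unfold scale. destruct (lo_cases N n) as [[_ ->]|[? ->]]; [ring|].
  rewrite H by easy. ring.
Qed.

Lemma form_mh_bounded gamma C : 0 <= C -> form_bound gamma C -> mh_bounded gamma.
Proof.
  (* [mh_bounded] wants a positive constant, and C may be 0. *)
  intros HC H. exists (C + 1). split; [lra|]. intros a b N Ha Hb.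
  eapply Rle_trans; [apply (H N N a (fun m => Cconj (b m)))|]. rewrite nrm_conj.
  pose proof (nrm_le_l2norm a N (fin_supp_l2 a N Ha)).
  pose proof (nrm_le_l2norm b N (fin_supp_l2 b N Hb)).
  pose proof (nrm_nonneg a N). pose proof (nrm_nonneg b N).
  apply Rmult_le_compat; try easy; [now apply Rmult_le_pos|apply Rmult_le_compat; lra].
Qed.

(** * Compactness *)

Lemma strictly_increasing_ge (phi : nat -> nat) :
  (forall k, (phi k < phi (S k))%nat) -> forall k, (k <= phi k)%nat.
Proof. intros H k. induction k as [|k IH]; [lia|]. specialize (H k); lia. Qed.

Lemma strictly_increasing_lt (phi : nat -> nat) :
  (forall k, (phi k < phi (S k))%nat) -> forall k l, (k < l)%nat -> (phi k < phi l)%nat.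
Proof.
  intros H k l Hkl. induction Hkl as [|l _ IH]; [apply H|]. specialize (H l); lia.
Qed.

Lemma bounded_subsequence (v : nat -> R) (B : R) : (forall k, Rabs (v k) <= B) ->
  exists psi : nat -> nat, (forall k, (psi k < psi (S k))%nat) /\
    exists l : R, is_lim_seq (fun k => v (psi k)) l.
Proof.
  intros H.
  destruct (Bolzano_Weierstrass v (fun x => - B <= x <= B)) as [l Hl].
  - apply compact_P3.
  - intros n. apply Rabs_le_between, H.
  (* From the state (k, N), pick an index from N on whose value is within 1 / (k + 1) of the cluster
     point. *)
  - assert (Hch : forall p : nat * nat, exists q, (snd p <= q)%nat /\ Rabs (v q - l) < / INR (S (fst p))).
    { intros [k N]; simpl fst; simpl snd.
      assert (Hp : 0 < / INR (S k)) by (apply Rinv_0_lt_compat, lt_0_INR; lia).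
      destruct (Hl (disc l (mkposreal _ Hp)) N) as [q [Hq1 Hq2]].
      - exists (mkposreal _ Hp). intros x Hx; exact Hx.
      - exists q. split; [easy|exact Hq2]. }
    apply functional_choice in Hch. destruct Hch as [f Hf].
    set (psi := fix psi k := match k with O => f (0, 0)%nat | S k' => f (S k', S (psi k')) end).
    exists psi. split.
    + intros k. apply (Hf (S k, S (psi k))).
    + exists l. assert (Hd : forall k, Rabs (v (psi k) - l) < / INR (S k)).
      { intros [|k]; [apply (Hf (0, 0)%nat)|apply (Hf (S k, S (psi k)))]. }
      apply is_lim_seq_spec. intros eps.
      destruct (archimed_cor1 eps (cond_pos eps)) as [N [HN HN0]].
      exists N. intros n Hn. eapply Rlt_trans; [apply Hd|].
      eapply Rle_lt_trans; [|exact HN].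
      apply Rinv_le_contravar; [apply lt_0_INR; lia|apply le_INR; lia].
Qed.

(** Cantor's diagonal argument: the subsequences [Phi i] are nested, and coordinate i converges
    along [Phi (S i)]. *)
Lemma pointwise_subsequence (u : nat -> nat -> R) (B : nat -> R) :
  (forall k i, Rabs (u k i) <= B i) ->
  exists phi : nat -> nat, (forall k, (phi k < phi (S k))%nat) /\
    exists l : nat -> R, forall i, is_lim_seq (fun k => u (phi k) i) (l i).
Proof.
  intros H.
  assert (Hch : forall p : (nat -> nat) * nat, exists psi : nat -> nat,
    (forall k, (psi k < psi (S k))%nat) /\
    exists l : R, is_lim_seq (fun k => u (fst p (psi k)) (snd p)) l).
  { intros [phi i]; simpl. apply (bounded_subsequence (fun k => u (phi k) i) (B i)). intros; apply H. }
  apply functional_choice in Hch. destruct Hch as [sel Hsel].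
  set (Phi := fix Phi i : nat -> nat :=
    match i with O => fun k => k | S i' => fun k => Phi i' (sel (Phi i', i') k) end).
  assert (HPhi : forall i k, (Phi i k < Phi i (S k))%nat).
  { induction i as [|i IH]; intros k; simpl; [lia|].
    apply strictly_increasing_lt; [easy|]. apply (Hsel (Phi i, i)). }
  (* A later subsequence runs through the earlier one at least as fast, so the diagonal is
     eventually a subsequence of each [Phi i]. *)
  assert (Hsub : forall i j n, exists n', (n <= n')%nat /\ Phi (i + j)%nat n = Phi i n').
  { intros i j. induction j as [|j IH]; intros n.
    - exists n. now rewrite Nat.add_0_r.
    - rewrite Nat.add_succ_r. simpl.
      destruct (IH (sel (Phi (i + j)%nat, (i + j)%nat) n)) as [n' [H1 H2]].
      exists n'. split; [|easy]. eapply Nat.le_trans; [|exact H1].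
      apply strictly_increasing_ge. apply (Hsel (Phi (i + j)%nat, (i + j)%nat)). }
  exists (fun k => Phi k k). split.
  - intros k. destruct (Hsub k 1%nat (S k)) as [n' [H1 H2]]. rewrite Nat.add_1_r in H2.
    rewrite H2. apply strictly_increasing_lt; [easy|lia].
  - apply (functional_choice (fun i (l : R) => is_lim_seq (fun k => u (Phi k k) i) l)). intros i.
    destruct (Hsel (Phi i, i)) as [_ [l Hl]]. exists l. simpl in Hl.
    apply is_lim_seq_spec in Hl. apply is_lim_seq_spec. intros eps.
    destruct (Hl eps) as [N HN]. exists (max N (S i)). intros n Hn.
    destruct (Hsub (S i) (n - S i)%nat n) as [n' [H1 H2]].
    replace (S i + (n - S i))%nat with n in H2 by lia. rewrite H2. apply HN. lia.
Qed.

Lemma cpointwise_subsequence (v : nat -> nat -> C) (B : R) :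
  (forall k i, Cmod (v k i) <= B) ->
  exists phi : nat -> nat, (forall k, (phi k < phi (S k))%nat) /\
    exists y : nat -> C, forall i, cconv (fun k => v (phi k) i) (y i).
Proof.
  intros H.
  destruct (pointwise_subsequence (fun k i => fst (v k i)) (fun _ => B)) as (phi & H1 & l & H2).
  { intros. eapply Rle_trans; [apply Cmod_fst_le|apply H]. }
  destruct (pointwise_subsequence (fun k i => snd (v (phi k) i)) (fun _ => B)) as (psi & H3 & l' & H4).
  { intros. eapply Rle_trans; [apply Cmod_snd_le|apply H]. }
  exists (fun k => phi (psi k)). split.
  - intros k. apply strictly_increasing_lt; [easy|apply H3].
  - exists (fun i => (l i, l' i)). intros i. split; simpl; [|apply H4].
    apply (is_lim_seq_subseq (fun k => fst (v (phi k) i)) (l i) psi); [|apply H2].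
    intros P [N HN]. exists N. intros n Hn. apply HN.
    pose proof (strictly_increasing_ge psi H3 n). lia.
Qed.

Lemma nrm_lo_le w K L : nrm (scale (lo K) w) L <= nrm w K.
Proof.
  destruct (l2_finite w K) as [H1 H2]. eapply Rle_trans; [now apply nrm_le_l2norm|easy].
Qed.

(** Coordinatewise convergence of a subsequence of images becomes convergence in norm because the
    tails are uniformly small. *)
Lemma vanishing_tail_compact gamma C : 0 <= C -> form_bound gamma C -> vanishing_tail gamma ->
  is_compact_op (Mop gamma).
Proof.
  intros HC H Hv. split; [now apply Mop_bounded with C|].
  intros u Hu [c0 Hc0]. set (c := Rmax 0 c0).
  assert (Hc : 0 <= c) by apply Rmax_l.
  assert (Huc : forall k, l2norm (u k) <= c) by (intros k; eapply Rle_trans; [apply Hc0|apply Rmax_r]).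
  assert (Hvk : forall k N, nrm (Mop gamma (u k)) N <= C * c).
  { intros k N. destruct (Mop_bound gamma C (u k) HC H (Hu k)) as [H1 H2].
    eapply Rle_trans; [now apply nrm_le_l2norm|]. eapply Rle_trans; [exact H2|].
    now apply Rmult_le_compat_l. }
  destruct (cpointwise_subsequence (fun k => Mop gamma (u k)) (C * c)) as (phi & Hphi & y & Hy).
  { intros k i. eapply Rle_trans; [apply (nrm_coord _ (S i)); lia|apply Hvk]. }
  exists phi, y. split; [easy|]. split.
  { apply (l2norm_le y (C * c)). intros N.
    apply (nrm_conv_le (fun k => Mop gamma (u (phi k)))); [easy|]. intros; apply Hvk. }
  apply is_lim_seq_spec. intros eps. pose proof (cond_pos eps) as Heps.
  (* [eta] for the first K coordinates and [eta * c] for each of the two tails add up to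
     [eps / 2]. *)
  set (eta := eps / (2 * (1 + 2 * c))).
  assert (Heta : 0 < eta) by (apply Rdiv_lt_0_compat; lra).
  destruct (Hv eta Heta) as [K HK].
  assert (Htv : forall k L, nrm (scale (hi K) (Mop gamma (u k))) L <= eta * c).
  { intros k L. eapply Rle_trans; [apply (Mop_tail gamma C eta); auto; lra|].
    apply Rmult_le_compat_l; [lra|easy]. }
  assert (Hty : forall L, nrm (scale (hi K) y) L <= eta * c).
  { intros L. apply (nrm_conv_le (fun k => scale (hi K) (Mop gamma (u (phi k))))).
    - intros m. now apply cconv_scal.
    - intros; apply Htv. }
  set (d := fun k n => Cminus (Mop gamma (u (phi k)) n) (y n)).
  assert (Hd : is_lim_seq (fun k => nrm2 (d k) K) 0).
  { replace (Finite 0) with (Finite (nrm2 (fun _ => RtoC 0) K)).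
    - apply nrm2_conv. intros m.
      replace (RtoC 0) with (Cplus (y m) (Cmult (RtoC (-1)) (y m))) by ring.
      apply cconv_ext_loc with
        (fun k => Cplus (Mop gamma (u (phi k)) m) (Cmult (RtoC (-1)) (y m))).
      + exists 0%nat. intros k _. unfold d. ring.
      + apply cconv_lin; [easy|apply cconv_const].
    - f_equal. apply rsum_zero. intros; rewrite Cmod_0; ring. }
  apply is_lim_seq_spec in Hd.
  destruct (Hd (mkposreal (eta ^ 2) (pow_lt _ 2 Heta))) as [N HN]; simpl in HN.
  exists N. intros k Hk. specialize (HN k Hk). fold (d k).
  rewrite Rminus_0_r in *. rewrite Rabs_pos_eq in * by (apply l2norm_nonneg || apply nrm2_nonneg).
  assert (Hlow : nrm (d k) K <= eta) by (apply nrm_le_of_sqr; simpl; lra).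
  apply Rle_lt_trans with (eta + (eta * c + eta * c)).
  - apply l2norm_le. intros L.
    rewrite (nrm_ext (d k) (vadd (scale (lo K) (d k)) (vadd (scale (hi K) (Mop gamma (u (phi k))))
      (fun n => Cmult (RtoC (-1)) (scale (hi K) y n))))).
    + eapply Rle_trans; [apply nrm_triangle|]. apply Rplus_le_compat.
      * eapply Rle_trans; [apply nrm_lo_le|easy].
      * eapply Rle_trans; [apply nrm_triangle|]. apply Rplus_le_compat; [apply Htv|].
        rewrite nrm_cscal, Cmod_R, Rabs_left by lra. specialize (Hty L). lra.
    + intros n _. unfold vadd, scale, d.
      destruct (lo_cases K n) as [[? ->]|[? ->]], (hi_cases K n) as [[? ->]|[? ->]]; try lia; ring.
  - replace (eta + (eta * c + eta * c)) with (eps / 2) by (unfold eta; field; lra). lra.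
Qed.

(** Otherwise there are unit-ball vectors u_K whose images keep mass above [eps] beyond K. A
    convergent subsequence of images would force the same on its limit, whose tails vanish. *)
Lemma compact_tail T eps : is_compact_op T -> 0 < eps ->
  exists K, forall x L, in_l2 x -> nrm (scale (hi K) (T x)) L <= eps * l2norm x.
Proof.
  intros [HT HTc] Heps.
  enough (Hex : exists K, forall x L, in_l2 x -> l2norm x <= 1 -> nrm (scale (hi K) (T x)) L <= eps).
  { destruct Hex as [K HK]. exists K. intros x L. revert x.
    apply homogeneous_bound; [easy|apply hi_abs|]. intros; now apply HK. }
  apply NNPP. intros Hn.
  assert (Hch : forall K, exists x, in_l2 x /\ l2norm x <= 1 /\
    exists L, eps < nrm (scale (hi K) (T x)) L).
  { intros K. apply NNPP. intros HK. apply Hn. exists K. intros x L Hx Hx1.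
    apply Rnot_lt_le. intros Hlt. apply HK. exists x. eauto. }
  apply functional_choice in Hch. destruct Hch as [u Hu].
  destruct (HTc u) as (phi & y & Hphi & Hy & Hlim).
  { intros k; apply Hu. }
  { exists 1. intros k; apply Hu. }
  destruct (bounded_nrm_tail y (l2norm y) (eps / 2)) as [N1 HN1];
    [intros; now apply nrm_le_l2norm|lra|].
  apply is_lim_seq_spec in Hlim.
  assert (He2 : 0 < eps / 2) by lra.
  destruct (Hlim (mkposreal _ He2)) as [N2 HN2]; simpl in HN2.
  set (k := max N1 N2). specialize (HN2 k (Nat.le_max_r _ _)).
  rewrite Rminus_0_r, Rabs_pos_eq in HN2 by apply l2norm_nonneg.
  destruct (Hu (phi k)) as (Hk1 & _ & L & HL).
  set (d := fun n => Cminus (T (u (phi k)) n) (y n)) in *.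
  assert (Hd : in_l2 d).
  { replace d with (fun n => Cplus (T (u (phi k)) n) (Cmult (RtoC (-1)) (y n))).
    - apply l2_lin; [|easy]. now apply (proj1 (proj2 HT)).
    - extensionality n. unfold d. ring. }
  rewrite (nrm_ext _ (vadd (scale (hi (phi k)) d) (scale (hi (phi k)) y))) in HL
    by (intros; unfold vadd, scale, d; ring).
  pose proof (nrm_triangle (scale (hi (phi k)) d) (scale (hi (phi k)) y) L).
  pose proof (nrm_scale_le1 (hi (phi k)) d L (hi_abs _)).
  pose proof (nrm_le_l2norm d L Hd).
  pose proof (strictly_increasing_ge phi Hphi k).
  specialize (HN1 (phi k) L ltac:(unfold k in *; lia)). lra.
Qed.

(** * The distance to the compact operators *)

Lemma form_bound_zero : form_bound (fun _ => RtoC 0) 0.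
Proof.
  intros M N a b. unfold form. rewrite csum_zero, Cmod_0; [lra|].
  intros n _. apply csum_zero; intros; ring.
Qed.

Lemma opnorm_nonneg T : is_bounded_op T -> 0 <= opnorm T.
Proof.
  intros H. destruct (bounded_op_const T H) as (c & Hc & Hb). now apply (opnorm_bounds T c).
Qed.

(** The zero operator competes and norms are nonnegative, so the infimum is finite. *)
Lemma dist_compact_spec T : is_bounded_op T -> exists e, 0 <= e /\ dist_compact T = Finite e /\
  (forall K, is_compact_op K -> e <= opnorm (op_sub T K)) /\
  (forall delta, 0 < delta -> exists K, is_compact_op K /\ opnorm (op_sub T K) < e + delta).
Proof.
  intros HT. unfold dist_compact.
  set (E := fun r => exists K, is_compact_op K /\ r = opnorm (op_sub T K)).
  destruct (Glb_Rbar_correct E) as [Hlb Hglb].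
  assert (HE : forall r, E r -> 0 <= r).
  { intros r (K & HK & ->). apply opnorm_nonneg, op_sub_bounded; [easy|apply HK]. }
  assert (H0 : E (opnorm (op_sub T (Mop (fun _ => RtoC 0))))).
  { exists (Mop (fun _ => RtoC 0)). split; [|easy].
    apply vanishing_tail_compact with 0; [lra|apply form_bound_zero|now apply vanishing_tail_zero]. }
  assert (Hge : Rbar_le 0 (Glb_Rbar E)) by (apply Hglb; intros r Hr; apply HE, Hr).
  assert (Hle := Hlb _ H0).
  destruct (Glb_Rbar E) as [e| |]; simpl in Hge, Hle; [|easy|easy].
  exists e. repeat split; try easy.
  - intros K HK. apply (Hlb (opnorm (op_sub T K))). now exists K.
  - intros delta Hd. apply NNPP. intros Hn.
    assert (Hc : Rbar_le (e + delta) e).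
    { apply Hglb. intros r (K & HK & ->). simpl. apply Rnot_lt_le. intros Hlt. apply Hn. now exists K. }
    simpl in Hc. lra.
Qed.

(** For a nearly optimal compact operator, the tail of the difference costs at most e + delta / 2
    and the tail of the compact operator at most delta / 2. *)
Lemma tail_bound_dist alpha C e : 0 <= C -> form_bound alpha C -> 0 <= e ->
  (forall delta, 0 < delta ->
     exists K, is_compact_op K /\ opnorm (op_sub (Mop alpha) K) < e + delta) ->
  forall delta, 0 < delta -> exists N, tail_bound alpha (e + delta) N.
Proof.
  intros HC H He Hex delta Hd. destruct (Hex (delta / 2)) as (T & HT & Hlt); [lra|].
  destruct (compact_tail T (delta / 2) HT) as [K HK]; [lra|].
  exists K. intros M N a b Hb. rewrite form_image.
  rewrite (csum_ext _ (fun m => Cmult (scale (hi K) (image alpha M a) m) (b m))).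
  2:{ intros m _. unfold scale. destruct (hi_cases K m) as [[? ->]|[_ ->]]; [|ring].
      rewrite Hb by easy. ring. }
  eapply Rle_trans; [apply csum_CS|]. apply Rmult_le_compat_r; [apply nrm_nonneg|].
  set (x := scale (lo M) a). destruct (l2_finite a M) as [Hx Hxn]. fold x in Hx, Hxn.
  rewrite <- (Mop_finite alpha C M a HC H). fold x.
  assert (Hbd : is_bounded_op (op_sub (Mop alpha) T))
    by (apply op_sub_bounded; [now apply Mop_bounded with C|apply HT]).
  rewrite (nrm_ext _ (vadd (scale (hi K) (op_sub (Mop alpha) T x)) (scale (hi K) (T x))))
    by (intros; unfold vadd, scale, op_sub; ring).
  eapply Rle_trans; [apply nrm_triangle|].
  pose proof (opnorm_nrm _ (hi K) N x Hbd (hi_abs K) Hx) as H1. specialize (HK x N Hx).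
  pose proof (l2norm_nonneg x).
  apply Rle_trans with ((e + delta) * l2norm x); [|apply Rmult_le_compat_l; lra].
  assert (opnorm (op_sub (Mop alpha) T) * l2norm x <= (e + delta / 2) * l2norm x)
    by (apply Rmult_le_compat_r; lra).
  lra.
Qed.

Lemma best_approx_of_form alpha beta C C' e : 0 <= C -> 0 <= C' -> 0 <= e ->
  form_bound alpha C -> form_bound beta C' -> vanishing_tail beta ->
  form_bound (fun k => Cminus (alpha k) (beta k)) e ->
  dist_compact (Mop alpha) = Finite e ->
  (forall K, is_compact_op K -> e <= opnorm (op_sub (Mop alpha) K)) ->
  best_mh_approx alpha beta.
Proof.
  intros HC HC' He Ha Hb Hv Hd Hdist Hlow.
  assert (Hcomp : is_compact_op (Mop beta)) by now apply vanishing_tail_compact with C'.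
  split; [now apply form_mh_bounded with C'|]. split; [easy|].
  rewrite Hdist. f_equal. apply Rle_antisym; [|now apply Hlow].
  apply opnorm_bounds; [easy|]. intros x Hx.
  rewrite (Mop_sub alpha beta C C') by easy. now apply Mop_bound.
Qed.

(** The first unit vector reads off the symbol, so bounded symbols that differ at a positive
    argument give different operators. *)
Lemma Mop_first gamma C n : 0 <= C -> form_bound gamma C ->
  Mop gamma (scale (lo 1) (fun _ => RtoC 1)) n = gamma (S n).
Proof.
  intros HC H. rewrite (Mop_finite gamma C) by easy. unfold image. simpl.
  rewrite Nat.add_0_r, Nat.add_1_r. ring.
Qed.

Theorem theorem1 (alpha : nat -> C) (Hb : mh_bounded alpha) :
  (exists beta : nat -> C, best_mh_approx alpha beta) /\
  (~ is_compact_op (Mop alpha) ->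
     exists beta1 beta2 : nat -> C,
       best_mh_approx alpha beta1 /\ best_mh_approx alpha beta2 /\
       exists x, in_l2 x /\ Mop beta1 x <> Mop beta2 x).
Proof.
  destruct (mh_bounded_form alpha Hb) as (C & HC & Ha).
  destruct (dist_compact_spec (Mop alpha)) as (e & He & Hdist & Hlow & Hex);
    [now apply Mop_bounded with C|].
  pose proof (tail_bound_dist alpha C e HC Ha He Hex) as Htail.
  destruct (Req_dec e 0) as [E0|E0].
  (* For e = 0 the iteration has no slack, but here T itself has vanishing tails and [alpha] is its
     own minimizer. *)
  - assert (Hv : vanishing_tail alpha).
    { intros eps Heps. destruct (Htail eps Heps) as [K HK]. exists K.
      now rewrite E0, Rplus_0_l in HK. }
    split.
    + exists alpha. apply best_approx_of_form with C C e; auto.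
      rewrite E0. apply form_bound_tail. eapply tail_bound_ext.
      2:{ apply form_bound_tail, form_bound_zero. }
      intros k _. simpl. ring.
    + intros Hn. exfalso. apply Hn. now apply vanishing_tail_compact with C.
  - assert (He0 : 0 < e) by lra.
    assert (Hbest : forall g, form_bound (sym_mul alpha (fun k => 1 - g k)) e ->
      form_bound (sym_mul alpha g) C -> vanishing_tail (sym_mul alpha g) ->
      best_mh_approx alpha (sym_mul alpha g)).
    { intros g H1 H2 H3. apply best_approx_of_form with C C e; auto.
      apply form_bound_tail. eapply tail_bound_ext; [|apply form_bound_tail, H1].
      intros k _. unfold sym_mul. rewrite RtoC_minus. ring. }
    (* Any positive [eps0] would do for the first minimizer. *)
    destruct (multiplier_exists alpha C e 1 HC He0 Rlt_0_1 Ha Htail)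
      as (g1 & G1 & G2 & G3 & G4 & G5).
    split; [exists (sym_mul alpha g1); now apply Hbest|].
    intros Hn.
    (* Otherwise only the (1, 1) entry can be nonzero and T is compact. The argument has to be at
       least 2, since n^(-eps) is always 1 at n = 1. *)
    assert (Hk : exists n, alpha (S (S n)) <> RtoC 0).
    { apply NNPP. intros Hno. apply Hn. apply vanishing_tail_compact with C; [easy|easy|].
      intros eps Heps. exists 1%nat. intros M N a b Hb0.
      unfold form. rewrite csum_zero, Cmod_0.
      - repeat apply Rmult_le_pos; try apply nrm_nonneg; lra.
      - intros n _. apply csum_zero. intros m _. destruct m as [|m].
        + rewrite Hb0 by lia. ring.
        + assert (E : alpha ((n + 1) * (S m + 1))%nat = RtoC 0).
          { apply NNPP. intros Hne. apply Hno. exists ((n + 1) * (S m + 1) - 2)%nat.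
            replace (S (S ((n + 1) * (S m + 1) - 2))) with ((n + 1) * (S m + 1))%nat by nia. easy. }
          rewrite E. ring. }
    destruct Hk as [n Hk].
    pose proof (G5 (S (S n)) ltac:(lia)) as Hg1.
    (* Half of the gap between [g1] and 1: then n^(-eps) >= (1 + g1) / 2 > g1 at this argument, and
       [g2] lies above n^(-eps). *)
    destruct (pw_near_one 1 ((1 - g1 (S (S n))) / 2) (S (S n))) as (eps & Heps & Hpw); [lra|lra|].
    specialize (Hpw (S (S n)) ltac:(lia)).
    destruct (multiplier_exists alpha C e eps HC He0 (proj1 Heps) Ha Htail)
      as (g2 & F1 & F2 & F3 & F4 & F5).
    specialize (F4 (S (S n))).
    exists (sym_mul alpha g1), (sym_mul alpha g2).
    split; [now apply Hbest|]. split; [now apply Hbest|].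
    exists (scale (lo 1) (fun _ => RtoC 1)). split; [apply l2_finite|].
    intros Heq. apply (f_equal (fun f => f (S n))) in Heq.
    rewrite !(Mop_first _ C) in Heq by easy. unfold sym_mul in Heq.
    assert (Hz : Cmult (alpha (S (S n))) (RtoC (g1 (S (S n)) - g2 (S (S n)))) = RtoC 0)
      by (rewrite RtoC_minus; transitivity (Cminus (Cmult (alpha (S (S n))) (RtoC (g1 (S (S n)))))
            (Cmult (alpha (S (S n))) (RtoC (g2 (S (S n)))))); [ring|rewrite Heq; ring]).
    apply (Cmult_neq_0 (alpha (S (S n))) (RtoC (g1 (S (S n)) - g2 (S (S n))))); auto.
    intros H0. apply RtoC_inj in H0. lra.
Qed.
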